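(* Let $(C,P)$ be a Dorroh pair of coalgebras and let $T$ be a subspace of $C\ltimes_d P$. Let $D\subseteq C$, $R\subseteq Q\subseteq P$ and the linear map $\eta$ be constructed from $T$ as in the context, and let $\pi:P\to P/R$ be the canonical projection. Then $T$ is a subcoalgebra of $C\ltimes_d P$ if and only if the following hold: (a) $D$ is a subcoalgebra of $C$. (b) $Q$ is a $C$-subCoalgebra of $P$, $R$ is a $C$-Coideal of $Q$, and $\rho^P_l(Q)\subseteq D\otimes Q$ and $\rho^P_r(Q)\subseteq Q\otimes D$, where $\rho^P_l$ and $\rho^P_r$ are the left and right $C$-comodule structure maps of $P$. (Hence $Q$ and $Q/R$ are both $D$-Coalgebras.) (c) $\eta:D\to Q/R$ is a $C$-bicomodule (or, $D$-bicomodule) homomorphism, and for all $p\in Q$, $$\sum\eta(p_{(-1)})\otimes p_{(0)}=\sum\pi(p_1)\otimes p_2,\qquad \sum p_{(0)}\otimes\eta(p_{(1)})=\sum p_1\otimes\pi(p_2).$$ If this is the case, then $\eta$ is a coalgebra homomorphism, and hence it is a $C$-Coalgebra (or $D$-Coalgebra) homomorphism.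
   Context: Everything is over a field $k$, $\otimes=\otimes_k$. Coalgebras are coassociative, not necessarily counital, and coalgebra homomorphisms are linear maps commuting with comultiplications; comodules over a counital coalgebra are assumed counital. Write $\Delta(c)=\sum c_1\otimes c_2$, $\rho_l(p)=\sum p_{(-1)}\otimes p_{(0)}$, $\rho_r(p)=\sum p_{(0)}\otimes p_{(1)}$. A coideal of a coalgebra $X$ is a subspace $V$ with $\Delta(V)\subseteq V\otimes X+X\otimes V$ (no counit condition). $(C,P)$ is a Dorroh pair of coalgebras if $C$ and $P$ are coalgebras, $P$ is a $C$-bicomodule, and for all $p\in P$: $\sum p_1\otimes p_{2(0)}\otimes p_{2(1)}=\sum p_{(0)1}\otimes p_{(0)2}\otimes p_{(1)}$, $\sum p_{1(-1)}\otimes p_{1(0)}\otimes p_2=\sum p_{(-1)}\otimes p_{(0)1}\otimes p_{(0)2}$, $\sum p_{1(0)}\otimes p_{1(1)}\otimes p_2=\sum p_1\otimes p_{2(-1)}\otimes p_{2(0)}$. Then $C\ltimes_d P=C\oplus P$ is a coalgebra with $\Delta(c,p)=\sum (c_1,0)\otimes (c_2,0)+\sum (p_{(-1)},0)\otimes (0,p_{(0)})+\sum (0,p_{(0)})\otimes (p_{(1)},0)+\sum (0,p_1)\otimes (0,p_2)$. A $C$-Coalgebra is a coalgebra $P$ with a $C$-bicomodule structure such that $(C,P)$ is a Dorroh pair of coalgebras; a $C$-subCoalgebra is a subspace that is both a subcoalgebra and a $C$-subbicomodule; a $C$-Coideal is a subspace that is both a coideal and a $C$-subbicomodule; a $C$-Coalgebra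 homomorphism is a map that is both a coalgebra and a $C$-bicomodule homomorphism. A subcoalgebra $D$ of $C$ is a $C$-bicomodule via $\Delta$. For a subspace $T\subseteq C\ltimes_d P$ put $D=\{c\in C\mid (c,p)\in T\text{ for some }p\in P\}$, $Q=\{p\in P\mid (c,p)\in T\text{ for some }c\in C\}$, $R=\{p\in P\mid (0,p)\in T\}$. Then $R\subseteq Q$, and $\eta:D\to P/R$, $\eta(c)=p+R$ whenever $(c,p)\in T$, is a well-defined linear map with image $Q/R$. One has $T=\{(c,p)\mid c\in D,\ p\in Q,\ \eta(c)=p+R\}$.
   Formalization: That Q and Q/R are D-Coalgebras is claimed with counital D-coactions only when C is counital; otherwise all axioms but counitality are claimed, since D may be counital when C is not and the D-coaction on Q may then be zero. *)

(* Defs.v *)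
From HB Require Import structures.
From mathcomp Require Import all_boot all_order all_algebra.
From mathcomp Require Import boolp classical_sets.

Set Implicit Arguments.
Unset Strict Implicit.
Unset Printing Implicit Defensive.

Import GRing.Theory.
Local Open Scope ring_scope.
Local Open Scope quotient_scope.

(* The list [:: (u1, v1); ...; (un, vn)] stands for u1 ⊗ v1 + ... + un ⊗ vn;
   the tensor product is the quotient of the lists by the congruence generated
   by commutativity and bilinearity. *)

Section Tensor.
Variables (k : fieldType) (U V : lmodType k).

Inductive tens_rel : seq (U * V) -> seq (U * V) -> Prop :=
| tens_refl s : tens_rel s s
| tens_sym s t : tens_rel s t -> tens_rel t s
| tens_trans t s r : tens_rel s t -> tens_rel t r -> tens_rel s r
| tens_cat s s' t t' : tens_rel s s' -> tens_rel t t' ->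
    tens_rel (s ++ t) (s' ++ t')
| tens_comm s t : tens_rel (s ++ t) (t ++ s)
| tens_addl u u' v : tens_rel [:: (u + u', v)] [:: (u, v); (u', v)]
| tens_addr u v v' : tens_rel [:: (u, v + v')] [:: (u, v); (u, v')]
| tens_scale a u v : tens_rel [:: (a *: u, v)] [:: (u, a *: v)]
| tens_zero v : tens_rel [:: (0, v)] [::].

Definition tens_eqb (s t : seq (U * V)) : bool := `[< tens_rel s t >].

Lemma tens_eqb_equiv : equiv_class_of tens_eqb.
Proof.
split=> [s|s t|t s r].
- exact/asboolP/tens_refl.
- by apply/asboolP/asboolP; apply: tens_sym.
- by move=> /asboolP st /asboolP tr; apply/asboolP/(tens_trans st tr).
Qed.

Canonical tens_equiv := EquivRelPack tens_eqb_equiv.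
Canonical tens_encModRel := defaultEncModRel tens_eqb.

Definition tensor := {eq_quot tens_eqb}.
HB.instance Definition _ : EqQuotient _ tens_eqb tensor :=
  EqQuotient.on tensor.
HB.instance Definition _ := Choice.on tensor.

Lemma tens_piP s t : reflect (\pi_tensor s = \pi_tensor t) (tens_eqb s t).
Proof. exact: eqmodP. Qed.

Lemma tens_piE s t : tens_rel s t -> \pi_tensor s = \pi_tensor t.
Proof. by move=> st; apply/tens_piP/asboolP. Qed.

Lemma tens_reprE s : tens_rel (repr (\pi_tensor s)) s.
Proof. by apply/asboolP/tens_piP; rewrite reprK. Qed.

Lemma tens_surj x : exists s, x = \pi_tensor s.
Proof. by exists (repr x); rewrite reprK. Qed.

Definition tadd (x y : tensor) : tensor := \pi_tensor (repr x ++ repr y).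
Definition tscale (a : k) (x : tensor) : tensor :=
  \pi_tensor [seq (a *: p.1, p.2) | p <- repr x].
Definition tzero : tensor := \pi_tensor [::].
Definition topp (x : tensor) : tensor := tscale (-1) x.

Lemma tadd_pi s t : tadd (\pi s) (\pi t) = \pi_tensor (s ++ t).
Proof. by apply: tens_piE; apply: tens_cat; apply: tens_reprE. Qed.

Lemma tens_scale_rel a s t : tens_rel s t ->
  tens_rel [seq (a *: p.1, p.2) | p <- s] [seq (a *: p.1, p.2) | p <- t].
Proof.
elim=> {s t} [s|s t _|t s r _ h1 _|s s' t t' _ h1 _ h2|s t|u u' v|u v v'|b u v|v] /=.
- exact: tens_refl.
- exact: tens_sym.
- exact: tens_trans h1.
- by rewrite !map_cat; apply: tens_cat.
- by rewrite !map_cat; apply: tens_comm.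
- by rewrite scalerDr; apply: tens_addl.
- exact: tens_addr.
- by rewrite scalerA mulrC -scalerA; apply: tens_scale.
- by rewrite scaler0; apply: tens_zero.
Qed.

Lemma tscale_pi a s :
  tscale a (\pi s) = \pi_tensor [seq (a *: p.1, p.2) | p <- s].
Proof. by apply: tens_piE; apply: tens_scale_rel; apply: tens_reprE. Qed.

Fact taddA : associative tadd.
Proof.
move=> x y z; have [s ->] := tens_surj x; have [t ->] := tens_surj y; have [r ->] := tens_surj z.
by rewrite (tadd_pi t) (tadd_pi s) (tadd_pi s t) (tadd_pi _ r) catA.
Qed.
Fact taddC : commutative tadd.
Proof.
move=> x y; have [s ->] := tens_surj x; have [t ->] := tens_surj y.
by rewrite (tadd_pi s) (tadd_pi t); apply/tens_piE/tens_comm.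
Qed.
Fact tadd0 : left_id tzero tadd.
Proof. by move=> x; have [s ->] := tens_surj x; rewrite tadd_pi. Qed.

Lemma tscale_map_add a b s :
  tens_rel [seq ((a + b) *: p.1, p.2) | p <- s]
    ([seq (a *: p.1, p.2) | p <- s] ++ [seq (b *: p.1, p.2) | p <- s]).
Proof.
elim: s => [|[u v] s IHs] /=; first exact: tens_refl.
rewrite -cat1s -[X in tens_rel _ X]cat1s.
have h : tens_rel [:: ((a + b) *: u, v)] ([:: (a *: u, v)] ++ [:: (b *: u, v)]).
  by rewrite scalerDl; apply: tens_addl.
apply: tens_trans (tens_cat h IHs) _.
rewrite -catA; apply: tens_cat (tens_refl _) _.
rewrite -[X in tens_rel _ (_ ++ X)]cat1s !catA.
by apply: tens_cat (tens_refl _); apply: tens_comm.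
Qed.

Lemma tscale_map0 s : tens_rel [seq (0 *: p.1, p.2) | p <- s] [::].
Proof.
elim: s => [|[u v] s IHs] /=; first exact: tens_refl.
rewrite -cat1s -[X in tens_rel _ X]/([::] ++ [::]); apply: tens_cat IHs.
by rewrite scale0r; apply: tens_zero.
Qed.

Fact tscaleDl v : {morph tscale^~ v : a b / a + b >-> tadd a b}.
Proof.
move=> a b; have [s ->] := tens_surj v; rewrite !tscale_pi tadd_pi.
exact/tens_piE/tscale_map_add.
Qed.

Fact tscale1 : left_id 1 tscale.
Proof.
move=> x; have [s ->] := tens_surj x; rewrite tscale_pi; congr (\pi_tensor _).
by rewrite -[RHS]map_id; apply: eq_map => -[u v] /=; rewrite scale1r.
Qed.

Fact taddN : left_inverse tzero topp tadd.
Proof.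
move=> x; rewrite /topp -[X in tadd _ X]tscale1 -tscaleDl addNr.
by have [s ->] := tens_surj x; rewrite tscale_pi; apply/tens_piE/tscale_map0.
Qed.

HB.instance Definition _ :=
  GRing.isZmodule.Build tensor taddA taddC tadd0 taddN.

Fact tscaleA a b v : tscale a (tscale b v) = tscale (a * b) v.
Proof.
have [s ->] := tens_surj v; rewrite (tscale_pi b) (tscale_pi a) (tscale_pi (a * b)) -map_comp; congr (\pi_tensor _).
by apply: eq_map => -[u w] /=; rewrite scalerA.
Qed.

Fact tscaleDr : right_distributive tscale tadd.
Proof.
move=> a x y; have [s ->] := tens_surj x; have [t ->] := tens_surj y.
by rewrite (tadd_pi s) !(tscale_pi a) (tadd_pi (map _ s)) map_cat.
Qed.

HB.instance Definition _ := GRing.Zmodule_isLmodule.Build k tensor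
  tscaleA tscale1 tscaleDr tscaleDl.

Definition tpure (u : U) (v : V) : tensor := \pi_tensor [:: (u, v)].

Lemma tpureDl v : {morph tpure^~ v : u u' / u + u'}.
Proof.
move=> u u'; rewrite /tpure [RHS]tadd_pi; exact/tens_piE/tens_addl.
Qed.
Lemma tpureDr u : {morph tpure u : v v' / v + v'}.
Proof.
move=> v v'; rewrite /tpure [RHS]tadd_pi; exact/tens_piE/tens_addr.
Qed.
Lemma tpureZl a u v : tpure (a *: u) v = a *: tpure u v.
Proof. by rewrite [RHS]tscale_pi. Qed.
Lemma tpureZr a u v : tpure u (a *: v) = a *: tpure u v.
Proof. by rewrite -tpureZl; apply/tens_piE/tens_sym/tens_scale. Qed.

Lemma tens_sumE s : \pi_tensor s = \sum_(p <- s) tpure p.1 p.2.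
Proof.
elim: s => [|[u v] s IHs]; first by rewrite big_nil.
by rewrite big_cons -IHs [RHS]tadd_pi.
Qed.

Lemma tensP (x : tensor) : exists s, x = \sum_(p <- s) tpure p.1 p.2.
Proof. by have [s ->] := tens_surj x; exists s; apply: tens_sumE. Qed.

End Tensor.

Notation "U ⊗ V" := (tensor U V) (at level 40, left associativity).
Notation "u ⊗ₜ v" := (tpure u v) (at level 40, left associativity).

HB.lock Definition tlift (k : fieldType) (U V W : lmodType k)
    (f : U -> V -> W) (t : U ⊗ V) : W :=
  \sum_(p <- repr t) f p.1 p.2.

Section TensorLift.
Variables (k : fieldType) (U V W : lmodType k).

Definition bilinear_map (f : U -> V -> W) : Prop :=
  (forall v, linear (f^~ v)) /\ (forall u, linear (f u)).

Section Bilinear.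
Variables (f : U -> V -> W) (fP : bilinear_map f).

Let fDl u u' v : f (u + u') v = f u v + f u' v.
Proof. by have := fP.1 v 1 u u'; rewrite !scale1r. Qed.
Let fDr u v v' : f u (v + v') = f u v + f u v'.
Proof. by have := fP.2 u 1 v v'; rewrite !scale1r. Qed.
Let f0l v : f 0 v = 0.
Proof. by apply/(addrI (f 0 v)); rewrite -fDl !addr0. Qed.
Let f0r u : f u 0 = 0.
Proof. by apply/(addrI (f u 0)); rewrite -fDr !addr0. Qed.
Let fZl a u v : f (a *: u) v = a *: f u v.
Proof. by have := fP.1 v a u 0; rewrite addr0 f0l addr0. Qed.
Let fZr a u v : f u (a *: v) = a *: f u v.
Proof. by have := fP.2 u a v 0; rewrite addr0 f0r addr0. Qed.

Lemma tlift_rel (s t : seq (U * V)) : tens_rel s t ->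
  \sum_(p <- s) f p.1 p.2 = \sum_(p <- t) f p.1 p.2.
Proof.
elim=> {s t} [s|s t _|t s r _ -> _ ->|s s' t t' _ h1 _ h2|s t|u u' v|u v v'|a u v|v] //.
- by rewrite !big_cat h1 h2.
- by rewrite !big_cat /= addrC.
- by rewrite !big_cons !big_nil !addr0 fDl.
- by rewrite !big_cons !big_nil !addr0 fDr.
- by rewrite !big_cons !big_nil !addr0 fZl fZr.
- by rewrite !big_cons !big_nil !addr0 f0l.
Qed.

Lemma tlift_pi s : tlift f (\pi s) = \sum_(p <- s) f p.1 p.2.
Proof. by rewrite tlift.unlock; apply: tlift_rel; apply: tens_reprE. Qed.

Lemma tliftE u v : tlift f (u ⊗ₜ v) = f u v.
Proof. by rewrite /tpure tlift_pi big_seq1. Qed.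

Lemma tlift_linear : linear (tlift f).
Proof.
move=> a x y; have [s ->] := tens_surj x; have [t ->] := tens_surj y.
have -> : a *: \pi_(U ⊗ V) s = \pi_(U ⊗ V) [seq (a *: p.1, p.2) | p <- s].
  exact: tscale_pi.
rewrite [X in tlift f X]tadd_pi !tlift_pi big_cat big_map scaler_sumr /=.
by congr (_ + _); apply: eq_bigr => p _; rewrite fZl.
Qed.

End Bilinear.

Lemma tens_ext (g h : {linear U ⊗ V -> W}) :
  (forall u v, g (u ⊗ₜ v) = h (u ⊗ₜ v)) -> g =1 h.
Proof.
by move=> gh x; have [s ->] := tensP x; rewrite !linear_sum; apply: eq_bigr.
Qed.

End TensorLift.

Lemma tpure_bilinear (k : fieldType) (U V U' V' : lmodType k)
    (f : {linear U -> U'}) (g : {linear V -> V'}) :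
  bilinear_map (fun u v => f u ⊗ₜ g v).
Proof.
split=> w a x y /=; rewrite linearP ?(tpureDl, tpureDr).
- by rewrite tpureZl.
- by rewrite tpureZr.
Qed.

Definition tmap (k : fieldType) (U V U' V' : lmodType k)
    (f : {linear U -> U'}) (g : {linear V -> V'}) : U ⊗ V -> U' ⊗ V' :=
  tlift (fun u v => f u ⊗ₜ g v).

HB.instance Definition _ (k : fieldType) (U V U' V' : lmodType k)
    (f : {linear U -> U'}) (g : {linear V -> V'}) :=
  GRing.isLinear.Build k (U ⊗ V) (U' ⊗ V') *:%R (tmap f g)
    (tlift_linear (tpure_bilinear f g)).

Lemma tmapE (k : fieldType) (U V U' V' : lmodType k)
    (f : {linear U -> U'}) (g : {linear V -> V'}) u v :
  tmap f g (u ⊗ₜ v) = f u ⊗ₜ g v.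
Proof. exact: tliftE (tpure_bilinear f g) u v. Qed.

Section Assoc.
Variables (k : fieldType) (U V W : lmodType k).

Lemma tassoc_bilinear1 (w : W) :
  bilinear_map (fun (u : U) (v : V) => u ⊗ₜ (v ⊗ₜ w)).
Proof.
split=> x a y z /=.
- by rewrite tpureDl tpureZl.
- by rewrite tpureDl tpureZl tpureDr tpureZr.
Qed.

Lemma tassoc_bilinear :
  bilinear_map (fun (t : U ⊗ V) (w : W) => tlift (fun u v => u ⊗ₜ (v ⊗ₜ w)) t).
Proof.
split=> [w|t a w w']; first exact: tlift_linear (tassoc_bilinear1 w).
pose L w := HB.pack_for {linear U ⊗ V -> U ⊗ (V ⊗ W)}
  (tlift (fun (u : U) (v : V) => u ⊗ₜ (v ⊗ₜ w)))
  (GRing.isLinear.Build _ _ _ _ _ (tlift_linear (tassoc_bilinear1 w))).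
have [s ->] := tensP t.
suff: L (a *: w + w') (\sum_(p <- s) p.1 ⊗ₜ p.2) =
  a *: L w (\sum_(p <- s) p.1 ⊗ₜ p.2) + L w' (\sum_(p <- s) p.1 ⊗ₜ p.2) by [].
rewrite (linear_sum (L (a *: w + w'))) (linear_sum (L w)) (linear_sum (L w')).
rewrite scaler_sumr -big_split /=; apply: eq_bigr => p _.
by rewrite !(tliftE (tassoc_bilinear1 _)) !tpureDr !tpureZr.
Qed.

Definition tassoc : (U ⊗ V) ⊗ W -> U ⊗ (V ⊗ W) :=
  tlift (fun (t : U ⊗ V) w => tlift (fun u v => u ⊗ₜ (v ⊗ₜ w)) t).

HB.instance Definition _ :=
  GRing.isLinear.Build k ((U ⊗ V) ⊗ W) (U ⊗ (V ⊗ W)) *:%R tassoc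
    (tlift_linear tassoc_bilinear).

Lemma tassocE u v w : tassoc ((u ⊗ₜ v) ⊗ₜ w) = u ⊗ₜ (v ⊗ₜ w).
Proof.
by rewrite /tassoc (tliftE tassoc_bilinear) (tliftE (tassoc_bilinear1 w)).
Qed.

End Assoc.

Section Contract.
Variables (k : fieldType) (U V : lmodType k) (e : {linear U -> k^o}).

(* e ⊗ id and id ⊗ e, followed by the identifications k ⊗ V = V = V ⊗ k. *)
Definition tcontrl : U ⊗ V -> V := tlift (fun u v => (e u : k) *: v).
Definition tcontrr : V ⊗ U -> V := tlift (fun v u => (e u : k) *: v).

Lemma tcontrl_bilinear : bilinear_map (fun u (v : V) => (e u : k) *: v).
Proof.
split=> w a x y /=.
- by rewrite linearP scalerDl scalerA.
- by rewrite scalerDr !scalerA mulrC.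
Qed.

Lemma tcontrr_bilinear : bilinear_map (fun (v : V) u => (e u : k) *: v).
Proof. by split=> w; [apply: tcontrl_bilinear.2|apply: tcontrl_bilinear.1]. Qed.

HB.instance Definition _ :=
  GRing.isLinear.Build k (U ⊗ V) V *:%R tcontrl (tlift_linear tcontrl_bilinear).
HB.instance Definition _ :=
  GRing.isLinear.Build k (V ⊗ U) V *:%R tcontrr (tlift_linear tcontrr_bilinear).

Lemma tcontrlE u v : tcontrl (u ⊗ₜ v) = (e u : k) *: v.
Proof. exact: (tliftE tcontrl_bilinear). Qed.
Lemma tcontrrE v u : tcontrr (v ⊗ₜ u) = (e u : k) *: v.
Proof. exact: (tliftE tcontrr_bilinear). Qed.

End Contract.

Section Subspace.
Variables (k : fieldType) (V : lmodType k) (A : submodClosed V).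

Definition subsp := {x : V | x \in A}.
HB.instance Definition _ := SubChoice.on subsp.
HB.instance Definition _ := [SubChoice_isSubLmodule of subsp by <:].

Definition incl : subsp -> V := val.

Lemma incl_linear : linear incl.
Proof. by move=> a x y; rewrite /incl linearP. Qed.
HB.instance Definition _ :=
  GRing.isLinear.Build k subsp V *:%R incl incl_linear.

Lemma inclP x : incl x \in A. Proof. exact: valP x. Qed.

Lemma incl_inj : injective incl. Proof. exact: val_inj. Qed.

Lemma inclT x : x \in A -> exists y, incl y = x.
Proof. by move=> Ax; exists (Sub x Ax); rewrite /incl SubK. Qed.

(* A is a direct summand of V, by Zorn's lemma. *)
Lemma retr_ex : exists r : {linear V -> subsp}, cancel incl r.
Proof.
pose Pr (B : set V) := (forall a x y, B x -> B y -> B (a *: x + y)) /\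
  (forall x, B x -> x \in A -> x = 0).
have [|B [[Bl B0] Bmax]] := @Zorn_bigcup V Pr.
  move=> F FP Ftot; split=> [a x y [X FX Xx] [Y FY Yy]|x [X FX Xx]]; last first.
    exact: (FP _ FX).2.
  case: (Ftot X Y FX FY) => h.
  - by exists Y => //; apply: (FP _ FY).1 => //; apply: h.
  - by exists X => //; apply: (FP _ FX).1 => //; apply: h.
have AN x : x \in A -> - x \in A by move=> Ax; rewrite -scaleN1r rpredZ.
have B00 : B 0.
  apply: contrapT => nB0; have nB x : ~ B x.
    by move=> Bx; apply: nB0; have := Bl (-1) x x Bx Bx; rewrite scaleN1r addNr.
  apply: (Bmax (set1 0)).
    by split; [move=> x /nB|move=> h; apply: nB0; apply: h].
  split=> [a x y -> ->|x -> //]; by rewrite scaler0 addr0.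
have BZ a x : B x -> B (a *: x) by move=> Bx; rewrite -[_ *: _]addr0; apply: Bl.
have BD x y : B x -> B y -> B (x + y).
  by move=> Bx By; rewrite -[x]scale1r; apply: Bl.
have BN x : B x -> B (- x) by rewrite -scaleN1r; apply: BZ.
have dec v : exists a : subsp, B (v - incl a).
  apply: contrapT => nv.
  pose B' : set V := fun x => exists2 b, B b & exists c, x = b + c *: v.
  have B'P : Pr B'.
    split=> [a _ _ [b Bb [c ->]] [b' Bb' [c' ->]]|_ [b Bb [c ->]]].
      exists (a *: b + b'); first exact: Bl.
      by exists (a * c + c'); rewrite scalerDr addrACA scalerDl scalerA.
    case: (eqVneq c 0) => [->|c0]; first by rewrite scale0r addr0; apply: B0.
    move=> bA; case: nv.
    have [a aE] := inclT (rpredZ c^-1 bA); exists a.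
    rewrite aE scalerDr scalerA mulVf // scale1r opprD addrCA subrr addr0.
    exact/BN/BZ.
  apply: (Bmax B') => //; split=> [x Bx|B'B].
    by exists x => //; exists 0; rewrite scale0r addr0.
  apply: nv; exists 0; rewrite (linear0 incl) subr0; apply: B'B.
  by exists 0 => //; exists 1; rewrite scale1r add0r.
pose r v := projT1 (cid (dec v)).
have rP v : B (v - incl (r v)) by rewrite /r; case: cid.
have rU v a : B (v - incl a) -> r v = a.
  move=> va; apply: incl_inj; apply/eqP; rewrite -subr_eq0; apply/eqP.
  apply: B0; last by rewrite rpredD ?inclP // AN ?inclP.
  have -> : incl (r v) - incl a = (v - incl a) - (v - incl (r v)).
    by rewrite opprB [RHS]addrC addrA subrK.
  by apply: BD => //; apply: BN.
have r_lin : linear r.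
  move=> a x y; apply: rU; rewrite (linearP incl) opprD addrACA -scalerBr.
  by apply: Bl; apply: rP.
exists (HB.pack_for {linear V -> subsp} r
  (GRing.isLinear.Build _ _ _ _ r r_lin)) => x /=.
by apply: rU; rewrite subrr.
Qed.

(* A chosen linear retraction of V onto A; the choice does not matter where it
   is used below, see sub_comulE and the like. *)
Definition retr : {linear V -> subsp} := projT1 (cid retr_ex).

Lemma inclK : cancel incl retr. Proof. by rewrite /retr; case: cid. Qed.

Lemma retrK x : x \in A -> incl (retr x) = x.
Proof. by move=> /inclT[y <-]; rewrite inclK. Qed.

Definition quot_eqb (x y : V) : bool := x - y \in A.

Lemma subspN x : x \in A -> - x \in A.
Proof. by move=> Ax; rewrite -scaleN1r rpredZ. Qed.

Lemma quot_eqb_equiv : equiv_class_of quot_eqb.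
Proof.
have sym x y : quot_eqb x y -> quot_eqb y x.
  by rewrite /quot_eqb => /subspN; rewrite opprB.
split=> [x|x y|y x z]; rewrite ?/quot_eqb.
- by rewrite subrr rpred0.
- by apply/idP/idP; apply: sym.
- by move=> h1 h2; rewrite -[x](subrK y) -addrA rpredD.
Qed.

Canonical quot_equiv := EquivRelPack quot_eqb_equiv.
Canonical quot_encModRel := defaultEncModRel quot_eqb.

Definition quotsp := {eq_quot quot_eqb}.
HB.instance Definition _ : EqQuotient _ quot_eqb quotsp := EqQuotient.on quotsp.
HB.instance Definition _ := Choice.on quotsp.

Definition qpi (x : V) : quotsp := \pi_quotsp x.

Lemma qpiP x y : (qpi x = qpi y) <-> (x - y \in A).
Proof. by split=> [/eqmodP|h]; last exact/eqmodP. Qed.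

Lemma qpi_repr x : qpi (repr x) = x. Proof. exact: reprK. Qed.
Lemma repr_qpi x : repr (qpi x) - x \in A.
Proof. by apply/qpiP; rewrite qpi_repr. Qed.

Lemma qpi_surj x : exists y, x = qpi y.
Proof. by exists (repr x); rewrite qpi_repr. Qed.

Definition qadd (x y : quotsp) := qpi (repr x + repr y).
Definition qscale (a : k) (x : quotsp) := qpi (a *: repr x).
Definition qzero := qpi 0.
Definition qopp x := qscale (-1) x.

Lemma qadd_pi x y : qadd (qpi x) (qpi y) = qpi (x + y).
Proof. by apply/qpiP; rewrite opprD addrACA rpredD ?repr_qpi. Qed.
Lemma qscale_pi a x : qscale a (qpi x) = qpi (a *: x).
Proof. by apply/qpiP; rewrite -scalerBr rpredZ ?repr_qpi. Qed.

Fact qaddA : associative qadd.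
Proof. move=> x y z; have [{}x ->] := qpi_surj x; have [{}y ->] := qpi_surj y; have [{}z ->] := qpi_surj z.
by rewrite !qadd_pi addrA. Qed.
Fact qaddC : commutative qadd.
Proof. by move=> x y; have [{}x ->] := qpi_surj x; have [{}y ->] := qpi_surj y; rewrite !qadd_pi addrC. Qed.
Fact qadd0 : left_id qzero qadd.
Proof. by move=> x; have [{}x ->] := qpi_surj x; rewrite qadd_pi add0r. Qed.
Fact qaddN : left_inverse qzero qopp qadd.
Proof. by move=> x; have [{}x ->] := qpi_surj x; rewrite /qopp qscale_pi qadd_pi scaleN1r addNr. Qed.

HB.instance Definition _ :=
  GRing.isZmodule.Build quotsp qaddA qaddC qadd0 qaddN.

Fact qscaleA a b x : qscale a (qscale b x) = qscale (a * b) x.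
Proof. by have [{}x ->] := qpi_surj x; rewrite !qscale_pi scalerA. Qed.
Fact qscale1 : left_id 1 qscale.
Proof. by move=> x; have [{}x ->] := qpi_surj x; rewrite qscale_pi scale1r. Qed.
Fact qscaleDr : right_distributive qscale qadd.
Proof.
move=> a x y; have [{}x ->] := qpi_surj x; have [{}y ->] := qpi_surj y.
by rewrite !(qadd_pi, qscale_pi) scalerDr.
Qed.
Fact qscaleDl v : {morph qscale^~ v : a b / a + b >-> qadd a b}.
Proof. by move=> a b; have [x ->] := qpi_surj v; rewrite !(qadd_pi, qscale_pi) scalerDl. Qed.

HB.instance Definition _ := GRing.Zmodule_isLmodule.Build k quotsp
  qscaleA qscale1 qscaleDr qscaleDl.

Lemma qpi_linear : linear qpi.
Proof. by move=> a x y; rewrite -qadd_pi -qscale_pi. Qed.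
HB.instance Definition _ := GRing.isLinear.Build k V quotsp *:%R qpi qpi_linear.

(* A chosen linear section of the projection; again the choice does not
   matter, see quot_comulE and the like. *)
Definition sect (x : quotsp) : V := repr x - incl (retr (repr x)).

Lemma sect_qpi x : sect (qpi x) = x - incl (retr x).
Proof.
rewrite /sect; set y := repr _.
have h : incl (retr y) - incl (retr x) = y - x.
  have := retrK (repr_qpi x); rewrite -/y => <-.
  by rewrite (linearB retr) (linearB incl).
by apply/eqP; rewrite subr_eq addrAC -addrA h addrC subrK.
Qed.

Lemma sect_linear : linear sect.
Proof.
move=> a x y; have [{}x ->] := qpi_surj x; have [{}y ->] := qpi_surj y; rewrite -linearP !sect_qpi.
by rewrite (linearP retr) (linearP incl) opprD addrACA scalerBr.
Qed.
HB.instance Definition _ := GRing.isLinear.Build k quotsp V *:%R sect sect_linear.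

Lemma sectK : cancel sect qpi.
Proof.
move=> x; have [{}x ->] := qpi_surj x; rewrite sect_qpi; apply/qpiP.
by rewrite addrAC subrr add0r subspN ?inclP.
Qed.

End Subspace.

Arguments incl {k V} A x.
Arguments qpi {k V} A x.
Arguments sect {k V} A x.

Section Coalgebra.
Variable k : fieldType.

Definition coassociative (C : lmodType k) (d : {linear C -> C ⊗ C}) : Prop :=
  forall c, tassoc (tmap d idfun (d c)) = tmap idfun d (d c).

Definition is_counit (C : lmodType k) (d : {linear C -> C ⊗ C})
    (e : {linear C -> k^o}) : Prop :=
  forall c, tcontrl e (d c) = c /\ tcontrr e (d c) = c.

Definition has_counit (C : lmodType k) (d : {linear C -> C ⊗ C}) : Prop :=
  exists e : {linear C -> k^o}, is_counit d e.

Section Bicomodule.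
Variables (C X : lmodType k) (d : {linear C -> C ⊗ C}).
Variables (rl : {linear X -> C ⊗ X}) (rr : {linear X -> X ⊗ C}).

Definition bicomodule_axioms : Prop :=
  forall x,
  [/\ tassoc (tmap d idfun (rl x)) = tmap idfun rl (rl x),
      tassoc (tmap rr idfun (rr x)) = tmap idfun d (rr x)
    & tassoc (tmap rl idfun (rr x)) = tmap idfun rr (rl x)].

Definition counital_coactions : Prop :=
  forall e : {linear C -> k^o}, is_counit d e ->
  forall x, tcontrl e (rl x) = x /\ tcontrr e (rr x) = x.

(* The counit axioms are only required when the coalgebra is counital. *)
Definition is_bicomodule : Prop := bicomodule_axioms /\ counital_coactions.

End Bicomodule.

Section Dorroh.
Variables (C P : lmodType k).
Variables (dC : {linear C -> C ⊗ C}) (dP : {linear P -> P ⊗ P}).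
Variables (rl : {linear P -> C ⊗ P}) (rr : {linear P -> P ⊗ C}).

Definition Dorroh_compatible : Prop :=
  forall p,
  [/\ tmap idfun rr (dP p) = tassoc (tmap dP idfun (rr p)),
      tassoc (tmap rl idfun (dP p)) = tmap idfun dP (rl p)
    & tassoc (tmap rr idfun (dP p)) = tmap idfun rl (dP p)].

(* All the axioms of a Dorroh pair, except for the counitality of the
   coactions when C happens to be counital. This matters when restricting the
   coalgebra: a subcoalgebra D of a non-counital C may be counital, and then
   the coactions of D on a C-bicomodule need not be. *)
Definition Dorroh_axioms : Prop :=
  [/\ coassociative dC, coassociative dP, bicomodule_axioms dC rl rr
    & Dorroh_compatible].

(* (C, P) is a Dorroh pair, i.e. P is a C-Coalgebra. *)
Definition Dorroh_pair : Prop :=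
  [/\ coassociative dC, coassociative dP, is_bicomodule dC rl rr
    & Dorroh_compatible].

Definition inC (c : C) : C * P := (c, 0).
Definition inP (p : P) : C * P := (0, p).

Lemma inC_linear : linear inC.
Proof. by move=> a x y; congr (_, _); rewrite /= scaler0 addr0. Qed.
Lemma inP_linear : linear inP.
Proof. by move=> a x y; congr (_, _); rewrite /= scaler0 addr0. Qed.
HB.instance Definition _ :=
  GRing.isLinear.Build k C (C * P)%type *:%R inC inC_linear.
HB.instance Definition _ :=
  GRing.isLinear.Build k P (C * P)%type *:%R inP inP_linear.

(* The comultiplication of C ⋉_d P. *)
Definition Dorroh_comul (x : C * P) : (C * P)%type ⊗ (C * P)%type :=
  tmap inC inC (dC x.1) + tmap inC inP (rl x.2) + tmap inP inC (rr x.2)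
  + tmap inP inP (dP x.2).

Lemma Dorroh_comul_linear : linear Dorroh_comul.
Proof.
move=> a x y; rewrite /Dorroh_comul /= !linearP !scalerDr.
rewrite (addrACA (a *: _) _ (a *: _)) (addrACA (a *: _ + a *: _) _ (a *: _)).
by rewrite (addrACA (a *: _ + a *: _ + a *: _) _ (a *: _)).
Qed.
HB.instance Definition _ :=
  GRing.isLinear.Build k (C * P)%type ((C * P)%type ⊗ (C * P)%type) *:%R
    Dorroh_comul Dorroh_comul_linear.

End Dorroh.

Definition coalgebra_hom (X Y : lmodType k)
    (dX : {linear X -> X ⊗ X}) (dY : {linear Y -> Y ⊗ Y})
    (f : {linear X -> Y}) : Prop :=
  forall x, tmap f f (dX x) = dY (f x).

Definition bicomodule_hom (C X Y : lmodType k)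
    (rlX : {linear X -> C ⊗ X}) (rrX : {linear X -> X ⊗ C})
    (rlY : {linear Y -> C ⊗ Y}) (rrY : {linear Y -> Y ⊗ C})
    (f : {linear X -> Y}) : Prop :=
  forall x, tmap idfun f (rlX x) = rlY (f x) /\ tmap f idfun (rrX x) = rrY (f x).

Definition Coalgebra_hom (C X Y : lmodType k)
    (dX : {linear X -> X ⊗ X})
    (rlX : {linear X -> C ⊗ X}) (rrX : {linear X -> X ⊗ C})
    (dY : {linear Y -> Y ⊗ Y})
    (rlY : {linear Y -> C ⊗ Y}) (rrY : {linear Y -> Y ⊗ C})
    (f : {linear X -> Y}) : Prop :=
  coalgebra_hom dX dY f /\ bicomodule_hom rlX rrX rlY rrY f.

(* t belongs to A ⊗ B, seen as a subspace of U ⊗ V. *)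
Definition in_tensor (U V : lmodType k) (A : submodClosed U)
    (B : submodClosed V) (t : U ⊗ V) : Prop :=
  exists s : subsp A ⊗ subsp B, t = tmap (incl A) (incl B) s.

Section SubStructures.
Variables (C X : lmodType k) (d : {linear X -> X ⊗ X}).
Variables (rl : {linear X -> C ⊗ X}) (rr : {linear X -> X ⊗ C}).
Variable A : submodClosed X.

Let iA : {linear subsp A -> X} := incl A.

Definition subcoalgebra : Prop := forall x, x \in A -> in_tensor A A (d x).

(* d(A) is contained in A ⊗ X + X ⊗ A. *)
Definition coideal : Prop := forall x, x \in A ->
  exists (s : subsp A ⊗ X) (t : X ⊗ subsp A), d x = tmap iA idfun s + tmap idfun iA t.

(* rl(A) is contained in C ⊗ A and rr(A) in A ⊗ C. *)
Definition subbicomodule : Prop := forall x, x \in A ->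
  (exists s : C ⊗ subsp A, rl x = tmap idfun iA s) /\
  (exists s : subsp A ⊗ C, rr x = tmap iA idfun s).

Definition subCoalgebra : Prop := subcoalgebra /\ subbicomodule.
Definition Coideal : Prop := coideal /\ subbicomodule.

(* The structure maps induced on the subspace A. They are total functions, and
   are characterized by sub_comulE, ..., below when A is a substructure. *)
Definition sub_comul : {linear subsp A -> subsp A ⊗ subsp A} :=
  tmap (retr A) (retr A) \o d \o iA.
Definition sub_lcoact : {linear subsp A -> C ⊗ subsp A} :=
  tmap idfun (retr A) \o rl \o iA.
Definition sub_rcoact : {linear subsp A -> subsp A ⊗ C} :=
  tmap (retr A) idfun \o rr \o iA.

(* The coactions of a subspace D of C on A, when rl(A) is contained in D ⊗ A
   and rr(A) in A ⊗ D. *)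
Definition sub_lcoact_in (D : submodClosed C) :
    {linear subsp A -> subsp D ⊗ subsp A} :=
  tmap (retr D) (retr A) \o rl \o iA.
Definition sub_rcoact_in (D : submodClosed C) :
    {linear subsp A -> subsp A ⊗ subsp D} :=
  tmap (retr A) (retr D) \o rr \o iA.

(* The structure maps induced on X / A, characterized by quot_comulE, ...,
   below when A is a coideal, resp. a subbicomodule. *)
Definition quot_comul : {linear quotsp A -> quotsp A ⊗ quotsp A} :=
  tmap (qpi A) (qpi A) \o d \o sect A.
Definition quot_lcoact : {linear quotsp A -> C ⊗ quotsp A} :=
  tmap idfun (qpi A) \o rl \o sect A.
Definition quot_rcoact : {linear quotsp A -> quotsp A ⊗ C} :=
  tmap (qpi A) idfun \o rr \o sect A.

End SubStructures.
End Coalgebra.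

Section TensorMapTheory.
Variable k : fieldType.

Lemma tmap_comp (U V U' V' U'' V'' : lmodType k) (f : {linear U -> U'})
    (g : {linear V -> V'}) (f' : {linear U' -> U''}) (g' : {linear V' -> V''}) t :
  tmap f' g' (tmap f g t) = tmap (f' \o f) (g' \o g) t.
Proof.
have [s ->] := tensP t.
rewrite (linear_sum (tmap f g)) (linear_sum (tmap f' g')) (linear_sum (tmap (f' \o f) _)).
by apply: eq_bigr => p _; rewrite /= !tmapE.
Qed.

Lemma eq_tmap (U V U' V' : lmodType k) (f f' : {linear U -> U'})
    (g g' : {linear V -> V'}) : f =1 f' -> g =1 g' -> tmap f g =1 tmap f' g'.
Proof.
move=> ff' gg' t; have [s ->] := tensP t.
rewrite (linear_sum (tmap f g)) (linear_sum (tmap f' g')).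
by apply: eq_bigr => p _; rewrite /= !tmapE ff' gg'.
Qed.

Lemma tmap_id (U V : lmodType k) (f : {linear U -> U}) (g : {linear V -> V}) :
  f =1 id -> g =1 id -> tmap f g =1 id.
Proof.
move=> fE gE t; have [s ->] := tensP t.
rewrite (linear_sum (tmap f g)).
by apply: eq_bigr => p _; rewrite /= !tmapE fE gE.
Qed.

Lemma tmap_cancel (U V U' V' : lmodType k) (f : {linear U -> U'})
    (g : {linear V -> V'}) (f' : {linear U' -> U}) (g' : {linear V' -> V}) :
  cancel f f' -> cancel g g' -> cancel (tmap f g) (tmap f' g').
Proof. by move=> fK gK t; rewrite tmap_comp tmap_id. Qed.

Lemma qpi_incl (V : lmodType k) (A : submodClosed V) x : qpi A (incl A x) = 0.
Proof. by rewrite -(linear0 (qpi A)); apply/qpiP; rewrite subr0 inclP. Qed.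

Lemma tmap_0l (U V U' V' : lmodType k) (f : {linear U -> U'})
    (g : {linear V -> V'}) t : (forall x, f x = 0) -> tmap f g t = 0.
Proof.
move=> f0; have [s ->] := tensP t; rewrite (linear_sum (tmap f g)) big1 // => p _.
by rewrite /= tmapE f0 -[0](scale0r (0 : U')) tpureZl scale0r.
Qed.

Lemma tmap_0r (U V U' V' : lmodType k) (f : {linear U -> U'})
    (g : {linear V -> V'}) t : (forall x, g x = 0) -> tmap f g t = 0.
Proof.
move=> g0; have [s ->] := tensP t; rewrite (linear_sum (tmap f g)) big1 // => p _.
by rewrite /= tmapE g0 -[0](scale0r (0 : V')) tpureZr scale0r.
Qed.

(* A ⊗ B -> U ⊗ V is injective. *)
Lemma tmap_incl_inj (U V : lmodType k) (A : submodClosed U) (B : submodClosed V) :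
  injective (tmap (incl A) (incl B)).
Proof. exact: can_inj (tmap_cancel (@inclK k U A) (@inclK k V B)). Qed.

End TensorMapTheory.

Section InducedTheory.
Variables (k : fieldType) (C X : lmodType k) (d : {linear X -> X ⊗ X}).
Variables (rl : {linear X -> C ⊗ X}) (rr : {linear X -> X ⊗ C}).
Variable A : submodClosed X.

Lemma sub_comulE : subcoalgebra d A ->
  forall a, tmap (incl A) (incl A) (sub_comul d A a) = d (incl A a).
Proof.
move=> dA a; have [s sE] := dA _ (inclP a).
by rewrite /sub_comul /= sE (tmap_cancel (@inclK k X A) (@inclK k X A)).
Qed.

Lemma sub_lcoactE : subbicomodule rl rr A ->
  forall a, tmap idfun (incl A) (sub_lcoact rl A a) = rl (incl A a).
Proof.
move=> dA a; have [[s sE] _] := dA _ (inclP a); rewrite /sub_lcoact /= sE.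
by rewrite (@tmap_cancel k _ _ _ _ idfun _ idfun _ (frefl _) (@inclK k X A)).
Qed.

Lemma sub_rcoactE : subbicomodule rl rr A ->
  forall a, tmap (incl A) idfun (sub_rcoact rr A a) = rr (incl A a).
Proof.
move=> dA a; have [_ [s sE]] := dA _ (inclP a); rewrite /sub_rcoact /= sE.
by rewrite (@tmap_cancel k _ _ _ _ _ idfun _ idfun (@inclK k X A) (frefl _)).
Qed.

Lemma sub_lcoact_inE (D : submodClosed C) :
  (forall x, x \in A -> in_tensor D A (rl x)) ->
  forall a, tmap (incl D) (incl A) (sub_lcoact_in rl A D a) = rl (incl A a).
Proof.
move=> dA a; have [s sE] := dA _ (inclP a).
by rewrite /sub_lcoact_in /= sE (tmap_cancel (@inclK k C D) (@inclK k X A)).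
Qed.

Lemma sub_rcoact_inE (D : submodClosed C) :
  (forall x, x \in A -> in_tensor A D (rr x)) ->
  forall a, tmap (incl A) (incl D) (sub_rcoact_in rr A D a) = rr (incl A a).
Proof.
move=> dA a; have [s sE] := dA _ (inclP a).
by rewrite /sub_rcoact_in /= sE (tmap_cancel (@inclK k X A) (@inclK k C D)).
Qed.

Lemma quot_comulE : coideal d A ->
  forall x, quot_comul d A (qpi A x) = tmap (qpi A) (qpi A) (d x).
Proof.
move=> dA x; rewrite /quot_comul /= sect_qpi linearB (linearB (tmap _ _)).
have [s [t ->]] := dA _ (inclP (retr A x)).
rewrite (linearD (tmap (qpi A) (qpi A))) /= !tmap_comp.
have h y : (qpi A \o incl A) y = 0 by apply: qpi_incl.
by rewrite (tmap_0l _ _ h) (tmap_0r _ _ h) addr0 subr0.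
Qed.

Lemma quot_lcoactE : subbicomodule rl rr A ->
  forall x, quot_lcoact rl A (qpi A x) = tmap idfun (qpi A) (rl x).
Proof.
move=> dA x; rewrite /quot_lcoact /= sect_qpi linearB (linearB (tmap _ _)).
have [[s ->] _] := dA _ (inclP (retr A x)).
have h y : (qpi A \o incl A) y = 0 by apply: qpi_incl.
by rewrite /= tmap_comp (tmap_0r _ _ h) subr0.
Qed.

Lemma quot_rcoactE : subbicomodule rl rr A ->
  forall x, quot_rcoact rr A (qpi A x) = tmap (qpi A) idfun (rr x).
Proof.
move=> dA x; rewrite /quot_rcoact /= sect_qpi linearB (linearB (tmap _ _)).
have [_ [s ->]] := dA _ (inclP (retr A x)).
have h y : (qpi A \o incl A) y = 0 by apply: qpi_incl.
by rewrite /= tmap_comp (tmap_0l _ _ h) subr0.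
Qed.

End InducedTheory.

(* D, Q, R and η, as obtained from T. *)

Section SubspaceData.
Variables (k : fieldType) (C P : lmodType k) (T : submodClosed (C * P)%type).

Definition subD : {pred C} := fun c => `[< exists p, (c, p) \in T >].
Definition subQ : {pred P} := fun p => `[< exists c, (c, p) \in T >].
Definition subR : {pred P} := fun p => (0, p) \in T.

Lemma subD_closed : submod_closed subD.
Proof.
split; first by apply/asboolP; exists 0; apply: rpred0.
move=> a c c' /asboolP[p cp] /asboolP[p' cp']; apply/asboolP; exists (a *: p + p').
by have := rpredD (rpredZ a cp) cp'.
Qed.
Lemma subQ_closed : submod_closed subQ.
Proof.
split; first by apply/asboolP; exists 0; apply: rpred0.
move=> a p p' /asboolP[c cp] /asboolP[c' cp']; apply/asboolP; exists (a *: c + c').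
by have := rpredD (rpredZ a cp) cp'.
Qed.
Lemma subR_closed : submod_closed subR.
Proof.
split; first exact: (rpred0 T).
move=> a p p' pR p'R; rewrite [_ \in _]/((0, a *: p + p') \in T).
have := rpredD (rpredZ a pR) p'R.
by have -> : a *: (0, p) + (0, p') = (0, a *: p + p') :> C * P
  by congr (_, _); rewrite /= scaler0 addr0.
Qed.

HB.instance Definition _ := GRing.isSubmodClosed.Build k C subD subD_closed.
HB.instance Definition _ := GRing.isSubmodClosed.Build k P subQ subQ_closed.
HB.instance Definition _ := GRing.isSubmodClosed.Build k P subR subR_closed.

Lemma subRQ p : p \in subR -> p \in subQ.
Proof. by move=> pR; apply/asboolP; exists 0. Qed.

Definition subR_in_Q : {pred subsp subQ} := fun q => incl subQ q \in subR.
Lemma subR_in_Q_closed : submod_closed subR_in_Q.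
Proof.
split=> [|a x y xR yR]; rewrite unfold_in /subR_in_Q.
  by rewrite (linear0 (incl subQ)) rpred0.
by rewrite (linearP (incl subQ)) rpredD ?rpredZ.
Qed.
HB.instance Definition _ :=
  GRing.isSubmodClosed.Build k (subsp subQ) subR_in_Q subR_in_Q_closed.

Lemma subT_R c p p' : (c, p) \in T -> (c, p') \in T -> p - p' \in subR.
Proof.
move=> cp cp'; rewrite [_ \in _]/((0, p - p') \in T).
have := rpredD cp (subspN cp').
by have -> : (c, p) - (c, p') = (0, p - p') by congr (_, _); rewrite /= subrr.
Qed.

Lemma eta_ex (c : subsp subD) : exists q : subsp subQ, (incl subD c, incl subQ q) \in T.
Proof.
have /asboolP[p cp] := inclP c.
have Qp : p \in subQ by apply/asboolP; exists (incl subD c).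
by have [q qE] := inclT Qp; exists q; rewrite qE.
Qed.

Definition eta_lift (c : subsp subD) : subsp subQ := projT1 (cid (eta_ex c)).

Lemma eta_liftP c : (incl subD c, incl subQ (eta_lift c)) \in T.
Proof. by rewrite /eta_lift; case: cid. Qed.

Definition etaPR (c : subsp subD) : quotsp subR :=
  qpi subR (incl subQ (eta_lift c)).

(* η with codomain Q/R; etaPR has codomain P/R. *)
Definition etaQR (c : subsp subD) : quotsp subR_in_Q :=
  qpi subR_in_Q (eta_lift c).

Lemma etaE c p : (incl subD c, p) \in T -> etaPR c = qpi subR p.
Proof. by move=> cp; apply/qpiP/(subT_R (eta_liftP c)). Qed.

Lemma etaQE c q : (incl subD c, incl subQ q) \in T -> etaQR c = qpi subR_in_Q q.
Proof.
move=> cq; apply/qpiP; rewrite unfold_in /subR_in_Q (linearB (incl subQ)).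
exact: subT_R (eta_liftP c) cq.
Qed.

Lemma eta_lift_linear a c c' :
  (incl subD (a *: c + c'), incl subQ (a *: eta_lift c + eta_lift c')) \in T.
Proof.
rewrite (linearP (incl subD)) (linearP (incl subQ)).
exact: rpredD (rpredZ a (eta_liftP c)) (eta_liftP c').
Qed.

Lemma eta_linear : linear etaPR.
Proof.
move=> a c c'; rewrite (etaE (eta_lift_linear a c c')).
by rewrite (linearP (incl subQ)) (linearP (qpi subR)).
Qed.
HB.instance Definition _ :=
  GRing.isLinear.Build k (subsp subD) (quotsp subR) *:%R etaPR eta_linear.

Lemma etaQ_linear : linear etaQR.
Proof.
move=> a c c'; rewrite (etaQE (eta_lift_linear a c c')).
by rewrite (linearP (qpi subR_in_Q)).
Qed.
HB.instance Definition _ :=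
  GRing.isLinear.Build k (subsp subD) (quotsp subR_in_Q) *:%R etaQR etaQ_linear.

End SubspaceData.

Arguments subR_in_Q {k C P} T q.
Arguments etaPR {k C P} T c.
Arguments etaQR {k C P} T c.

(* Main.v *)
(* Write prD : T -> D and prQ : T -> Q for the two projections; by construction
   eta prD = pi prQ.  If T is a subcoalgebra, then each comultiplication
   Delta(c, q) comes from some s in T ⊗ T, and applying to s the four maps
   prD ⊗ prD, prD ⊗ prQ, prQ ⊗ prD and prQ ⊗ prQ yields Delta(c), rho_l(q),
   rho_r(q) and Delta(q); all identities about eta and pi then follow from
   eta prD = pi prQ.  Conversely, T ⊗ T is the set of tensors killed by both
   X/T ⊗ X and X ⊗ X/T, where X = C ⊕ P.  The inclusion of P in X induces
   theta : P/R -> X/T, and the class of (c, p) in X/T, for c in D, is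
   theta(pi(p) - eta(c)), so that the conditions on eta make the image of
   Delta(c, q) vanish on each side. *)

Require Import Defs.
From HB Require Import structures.
From mathcomp Require Import all_boot all_order all_algebra.
From mathcomp Require Import boolp.
Set Implicit Arguments.
Unset Strict Implicit.
Unset Printing Implicit Defensive.
Import GRing.Theory.
Local Open Scope ring_scope.

(** * Tensor products of linear maps, and kernels of tensored projections *)

Section TensorMaps.
Variable k : fieldType.

Lemma tmap_comp2 (U V U1 V1 U2 V2 U3 V3 : lmodType k)
    (f1 : {linear U -> U1}) (g1 : {linear V -> V1})
    (f2 : {linear U1 -> U3}) (g2 : {linear V1 -> V3})
    (f1' : {linear U -> U2}) (g1' : {linear V -> V2})
    (f2' : {linear U2 -> U3}) (g2' : {linear V2 -> V3}) t :
  (forall u, f2 (f1 u) = f2' (f1' u)) -> (forall v, g2 (g1 v) = g2' (g1' v)) ->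
  tmap f2 g2 (tmap f1 g1 t) = tmap f2' g2' (tmap f1' g1' t).
Proof. by move=> fE gE; rewrite !tmap_comp; apply: eq_tmap. Qed.

Lemma tmap_comp1 (U V U1 V1 U2 V2 : lmodType k)
    (f1 : {linear U -> U1}) (g1 : {linear V -> V1})
    (f2 : {linear U1 -> U2}) (g2 : {linear V1 -> V2})
    (f : {linear U -> U2}) (g : {linear V -> V2}) t :
  (forall u, f2 (f1 u) = f u) -> (forall v, g2 (g1 v) = g v) ->
  tmap f2 g2 (tmap f1 g1 t) = tmap f g t.
Proof. by move=> fE gE; rewrite tmap_comp; apply: eq_tmap. Qed.

(** Naturality of the associator, checked on pure tensors after expanding [t] and then each of its
    left factors. *)
Lemma tassoc_tmap (U V W U' V' W' : lmodType k) (f : {linear U -> U'})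
    (g : {linear V -> V'}) (h : {linear W -> W'}) t :
  tassoc (tmap (tmap f g) h t) = tmap f (tmap g h) (tassoc t).
Proof.
have tsum (I : Type) (r : seq I) (A B : lmodType k) (F : I -> A) (b : B) :
    (\sum_(i <- r) F i) ⊗ₜ b = \sum_(i <- r) F i ⊗ₜ b.
  elim: r => [|i r IH]; rewrite ?big_nil ?big_cons ?tpureDl ?IH //.
  by rewrite -[0](scale0r (0 : A)) tpureZl scale0r.
have [s ->] := tensP t.
rewrite (linear_sum (tmap _ h)) (linear_sum (@tassoc k U V W)).
rewrite (linear_sum (@tassoc k U' V' W')) (linear_sum (tmap f _)).
apply: eq_bigr => -[x w] _ /=; have [r ->] := tensP x.
rewrite tmapE (linear_sum (tmap f g)) !tsum !linear_sum.
by apply: eq_bigr => -[u v] _; rewrite /= !(tmapE, tassocE) /= tmapE.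
Qed.

Lemma tcontrl_tmap (U V U' V' : lmodType k) (e : {linear U -> k^o})
    (e' : {linear U' -> k^o}) (f : {linear U -> U'}) (g : {linear V -> V'}) t :
  (forall u, e' (f u) = e u) -> tcontrl e' (tmap f g t) = g (tcontrl e t).
Proof.
move=> eE; have [s ->] := tensP t; rewrite !linear_sum; apply: eq_bigr => p _ /=.
by rewrite tmapE !tcontrlE linearZ eE.
Qed.

Lemma tcontrr_tmap (U V U' V' : lmodType k) (e : {linear U -> k^o})
    (e' : {linear U' -> k^o}) (f : {linear U -> U'}) (g : {linear V -> V'}) t :
  (forall u, e' (f u) = e u) -> tcontrr e' (tmap g f t) = g (tcontrr e t).
Proof.
move=> eE; have [s ->] := tensP t; rewrite !linear_sum; apply: eq_bigr => p _ /=.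
by rewrite tmapE !tcontrrE linearZ eE.
Qed.

(** The splitting V = A ⊕ V/A given by the chosen retraction and section; the kernel computations
    below rest on it. *)
Lemma sect_retr (V : lmodType k) (A : submodClosed V) x :
  x = incl A (retr A x) + sect A (qpi A x).
Proof. by rewrite sect_qpi addrC subrK. Qed.

Lemma tmapDl (U V U' V' : lmodType k) (f f1 f2 : {linear U -> U'})
    (g : {linear V -> V'}) t : (forall u, f u = f1 u + f2 u) ->
  tmap f g t = tmap f1 g t + tmap f2 g t.
Proof.
move=> fE; have [s ->] := tensP t; rewrite !linear_sum -big_split.
by apply: eq_bigr => p _ /=; rewrite !tmapE fE tpureDl.
Qed.

Lemma tmapDr (U V U' V' : lmodType k) (f : {linear U -> U'})
    (g g1 g2 : {linear V -> V'}) t : (forall v, g v = g1 v + g2 v) ->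
  tmap f g t = tmap f g1 t + tmap f g2 t.
Proof.
move=> gE; have [s ->] := tensP t; rewrite !linear_sum -big_split.
by apply: eq_bigr => p _ /=; rewrite !tmapE gE tpureDr.
Qed.

Lemma tmapNl (U V U' V' : lmodType k) (f f' : {linear U -> U'})
    (g g' : {linear V -> V'}) t : (forall u, f u = - f' u) -> g =1 g' ->
  tmap f g t = - tmap f' g' t.
Proof.
move=> fE gE; have [s ->] := tensP t; rewrite !linear_sum.
apply: eq_bigr => p _ /=.
by rewrite !tmapE fE gE -scaleN1r tpureZl scaleN1r.
Qed.

Lemma tmapNr (U V U' V' : lmodType k) (f f' : {linear U -> U'})
    (g g' : {linear V -> V'}) t : f =1 f' -> (forall v, g v = - g' v) ->
  tmap f g t = - tmap f' g' t.
Proof.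
move=> fE gE; have [s ->] := tensP t; rewrite !linear_sum.
apply: eq_bigr => p _ /=.
by rewrite !tmapE fE gE -scaleN1r tpureZr scaleN1r.
Qed.

Lemma tensor_splitl (U V : lmodType k) (A : submodClosed U) (t : U ⊗ V) :
  t = tmap (incl A) idfun (tmap (retr A) idfun t)
    + tmap (sect A) idfun (tmap (qpi A) idfun t).
Proof.
rewrite !tmap_comp -[LHS](@tmap_id _ _ _ idfun idfun) //.
rewrite (@tmapDl _ _ _ _ _ (incl A \o retr A) (sect A \o qpi A)); last first.
  by move=> u; apply: sect_retr.
by congr (_ + _); apply: eq_tmap.
Qed.

Lemma tensor_splitr (U V : lmodType k) (B : submodClosed V) (t : U ⊗ V) :
  t = tmap idfun (incl B) (tmap idfun (retr B) t)
    + tmap idfun (sect B) (tmap idfun (qpi B) t).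
Proof.
rewrite !tmap_comp -[LHS](@tmap_id _ _ _ idfun idfun) //.
rewrite (@tmapDr _ _ _ _ _ _ (incl B \o retr B) (sect B \o qpi B)); last first.
  by move=> u; apply: sect_retr.
by congr (_ + _); apply: eq_tmap.
Qed.

(** Exactness of tensoring: in the splitting of [t] along A, the component through U/A vanishes. *)
Lemma ker_tmap_qpil (U V : lmodType k) (A : submodClosed U)
    (t : U ⊗ V) : tmap (qpi A) idfun t = 0 ->
  exists s : subsp A ⊗ V, t = tmap (incl A) idfun s.
Proof.
move=> t0; exists (tmap (retr A) idfun t).
by rewrite {1}[t](tensor_splitl A) t0 linear0 addr0.
Qed.

Lemma ker_tmap_qpir (U V : lmodType k) (B : submodClosed V)
    (t : U ⊗ V) : tmap idfun (qpi B) t = 0 ->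
  exists s : U ⊗ subsp B, t = tmap idfun (incl B) s.
Proof.
move=> t0; exists (tmap idfun (retr B) t).
by rewrite {1}[t](tensor_splitr B) t0 linear0 addr0.
Qed.

Lemma tmap_inclKl (U W : lmodType k) (A : submodClosed U) :
  cancel (tmap (incl A) (@idfun W)) (tmap (retr A) (@idfun W)).
Proof. by apply: tmap_cancel => //; apply: inclK. Qed.

Lemma tmap_inclKr (U W : lmodType k) (A : submodClosed U) :
  cancel (tmap (@idfun W) (incl A)) (tmap (@idfun W) (retr A)).
Proof. by apply: tmap_cancel => //; apply: inclK. Qed.

(** This is (A ⊗ V) ∩ (U ⊗ B) = A ⊗ B in terms of kernels: the first condition gives [s] in A ⊗ V,
    and injectivity of A ⊗ V/B -> U ⊗ V/B carries the second condition over to [s]. *)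
Lemma in_tensor_ker (U V : lmodType k) (A : submodClosed U)
    (B : submodClosed V) (t : U ⊗ V) :
  tmap (qpi A) idfun t = 0 -> tmap idfun (qpi B) t = 0 -> in_tensor A B t.
Proof.
move=> /ker_tmap_qpil[s ->] t0; exists (tmap idfun (retr B) s).
have {t0} : tmap (incl A) idfun (tmap idfun (qpi B) s) = 0.
  by rewrite -t0; apply: tmap_comp2.
rewrite -(linear0 (tmap (incl A) idfun)).
move/(can_inj (@tmap_inclKl _ _ _)).
by move=> /ker_tmap_qpir[{}s ->]; rewrite !tmap_comp;
  apply: eq_tmap => v /=; rewrite ?inclK.
Qed.

(** The kernel of π ⊗ π is A ⊗ V + V ⊗ A, which is the form needed to detect coideals. *)
Lemma ker_tmap_qpi (V : lmodType k) (A : submodClosed V) (t : V ⊗ V) :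
  tmap (qpi A) (qpi A) t = 0 ->
  exists (s : subsp A ⊗ V) (s' : V ⊗ subsp A),
    t = tmap (incl A) idfun s + tmap idfun (incl A) s'.
Proof.
move=> t0; exists (tmap (retr A) idfun t).
(* Applying [qpi] to the second factor of [w] gives the image under [sect ⊗ id] of (π ⊗ π)(t) = 0,
   so [w] lies in V ⊗ A. *)
set w := tmap (sect A) idfun (tmap (qpi A) idfun t).
have [|s' ws'] := @ker_tmap_qpir V V A w.
  rewrite -[RHS](linear0 (tmap (sect A) idfun)) -t0 /w !tmap_comp.
  by rewrite /= [RHS]tmap_comp; apply: eq_tmap.
by exists s'; rewrite -ws' -tensor_splitl.
Qed.

End TensorMaps.

(** * Transport of the Dorroh axioms and of counitality along injections and surjections *)

Section Transport.
Variable k : fieldType.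

(* Every axiom of a Dorroh pair, apart from counitality, is an instance of
   this identity (X -> U ⊗ V ⊗ Z). *)
Definition mixed_coassociative (X Y Z U V W : lmodType k)
    (a : {linear Y -> U ⊗ V}) (b : {linear X -> Y ⊗ Z})
    (a' : {linear W -> V ⊗ Z}) (b' : {linear X -> U ⊗ W}) : Prop :=
  forall x, tassoc (tmap a idfun (b x)) = tmap idfun a' (b' x).

Lemma Dorroh_axiomsE (C P : lmodType k) (dC : {linear C -> C ⊗ C})
    (dP : {linear P -> P ⊗ P}) (rl : {linear P -> C ⊗ P})
    (rr : {linear P -> P ⊗ C}) :
  Dorroh_axioms dC dP rl rr <->
  [/\ [/\ mixed_coassociative dC dC dC dC & mixed_coassociative dP dP dP dP],
      [/\ mixed_coassociative dC rl rl rl, mixed_coassociative rr rr dC rr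
        & mixed_coassociative rl rr rr rl]
    & [/\ mixed_coassociative dP rr rr dP, mixed_coassociative rl dP dP rl
        & mixed_coassociative rr dP rl dP]].
Proof.
split=> [[hC hP hb hD]|[[hC hP] [h1 h2 h3] [h4 h5 h6]]].
- split; split=> // x; try by case: (hb x).
  + by case: (hD x).
  + by case: (hD x).
  + by case: (hD x).
- split=> // x; split; rewrite ?h1 ?h2 ?h3 ?h5 ?h6 //; exact/esym/h4.
Qed.

Section Square.
Variables (X Y Z U V W X' Y' Z' U' V' W' : lmodType k).
Variables (a : {linear Y -> U ⊗ V}) (b : {linear X -> Y ⊗ Z}).
Variables (a' : {linear W -> V ⊗ Z}) (b' : {linear X -> U ⊗ W}).
Variables (A : {linear Y' -> U' ⊗ V'}) (B : {linear X' -> Y' ⊗ Z'}).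
Variables (A' : {linear W' -> V' ⊗ Z'}) (B' : {linear X' -> U' ⊗ W'}).
Variables (fX : {linear X -> X'}) (fY : {linear Y -> Y'}) (fZ : {linear Z -> Z'}).
Variables (fU : {linear U -> U'}) (fV : {linear V -> V'}) (fW : {linear W -> W'}).
Hypothesis aE : forall y, tmap fU fV (a y) = A (fY y).
Hypothesis bE : forall x, tmap fY fZ (b x) = B (fX x).
Hypothesis a'E : forall w, tmap fV fZ (a' w) = A' (fW w).
Hypothesis b'E : forall x, tmap fU fW (b' x) = B' (fX x).

(** [fU ⊗ fV ⊗ fZ] carries the left side of the unprimed identity to that of the primed one, and
    [rhsE] treats the right sides; the next two lemmas cancel this map or push along it. *)
Let lhsE x : tmap fU (tmap fV fZ) (tassoc (tmap a idfun (b x))) =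
  tassoc (tmap A idfun (B (fX x))).
Proof.
by rewrite -tassoc_tmap -bE; congr (tassoc _); apply: tmap_comp2.
Qed.

Let rhsE x : tmap fU (tmap fV fZ) (tmap idfun a' (b' x)) =
  tmap idfun A' (B' (fX x)).
Proof. by rewrite -b'E; apply: tmap_comp2. Qed.

(** A tensor product of maps with left inverses has a left inverse, so the identity may be checked
    after [fU ⊗ fV ⊗ fZ]. *)
Lemma mixed_coassociative_inj (gU : {linear U' -> U}) (gV : {linear V' -> V})
    (gZ : {linear Z' -> Z}) :
  cancel fU gU -> cancel fV gV -> cancel fZ gZ ->
  mixed_coassociative A B A' B' -> mixed_coassociative a b a' b'.
Proof.
move=> fUK fVK fZK H x.
apply: (can_inj (tmap_cancel fUK (tmap_cancel fVK fZK))).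
by rewrite lhsE rhsE H.
Qed.

Lemma mixed_coassociative_surj : (forall x', exists x, x' = fX x) ->
  mixed_coassociative a b a' b' -> mixed_coassociative A B A' B'.
Proof. by move=> fXs H x'; have [x ->] := fXs x'; rewrite -lhsE -rhsE H. Qed.

End Square.

Section DorrohTransport.
Variables (C P C' P' : lmodType k).
Variables (dC : {linear C -> C ⊗ C}) (dP : {linear P -> P ⊗ P}).
Variables (rl : {linear P -> C ⊗ P}) (rr : {linear P -> P ⊗ C}).
Variables (dC' : {linear C' -> C' ⊗ C'}) (dP' : {linear P' -> P' ⊗ P'}).
Variables (rl' : {linear P' -> C' ⊗ P'}) (rr' : {linear P' -> P' ⊗ C'}).
Variables (f : {linear C -> C'}) (g : {linear P -> P'}).
Hypothesis dCE : forall c, tmap f f (dC c) = dC' (f c).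
Hypothesis dPE : forall p, tmap g g (dP p) = dP' (g p).
Hypothesis rlE : forall p, tmap f g (rl p) = rl' (g p).
Hypothesis rrE : forall p, tmap g f (rr p) = rr' (g p).

Lemma Dorroh_axioms_inj (f' : {linear C' -> C}) (g' : {linear P' -> P}) :
  cancel f f' -> cancel g g' ->
  Dorroh_axioms dC' dP' rl' rr' -> Dorroh_axioms dC dP rl rr.
Proof.
move=> fK gK /Dorroh_axiomsE[[h1 h2] [h3 h4 h5] [h6 h7 h8]].
apply/Dorroh_axiomsE; split; split.
- exact (mixed_coassociative_inj dCE dCE dCE dCE fK fK fK h1).
- exact (mixed_coassociative_inj dPE dPE dPE dPE gK gK gK h2).
- exact (mixed_coassociative_inj dCE rlE rlE rlE fK fK gK h3).
- exact (mixed_coassociative_inj rrE rrE dCE rrE gK fK fK h4).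
- exact (mixed_coassociative_inj rlE rrE rrE rlE fK gK fK h5).
- exact (mixed_coassociative_inj dPE rrE rrE dPE gK gK fK h6).
- exact (mixed_coassociative_inj rlE dPE dPE rlE fK gK gK h7).
- exact (mixed_coassociative_inj rrE dPE rlE dPE gK fK gK h8).
Qed.

Lemma Dorroh_axioms_surj :
  (forall c', exists c, c' = f c) -> (forall p', exists p, p' = g p) ->
  Dorroh_axioms dC dP rl rr -> Dorroh_axioms dC' dP' rl' rr'.
Proof.
move=> fS gS /Dorroh_axiomsE[[h1 h2] [h3 h4 h5] [h6 h7 h8]].
apply/Dorroh_axiomsE; split; split.
- exact (mixed_coassociative_surj dCE dCE dCE dCE fS h1).
- exact (mixed_coassociative_surj dPE dPE dPE dPE gS h2).
- exact (mixed_coassociative_surj dCE rlE rlE rlE gS h3).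
- exact (mixed_coassociative_surj rrE rrE dCE rrE gS h4).
- exact (mixed_coassociative_surj rlE rrE rrE rlE gS h5).
- exact (mixed_coassociative_surj dPE rrE rrE dPE gS h6).
- exact (mixed_coassociative_surj rlE dPE dPE rlE gS h7).
- exact (mixed_coassociative_surj rrE dPE rlE dPE gS h8).
Qed.

(** Every counit of C is [e'] composed with [f], so counitality with respect to [e'] is pulled back
    along the injective [g]. *)
Lemma counital_coactions_inj (e' : {linear C' -> k^o}) :
  is_counit dC' e' -> injective f -> injective g ->
  (forall p', tcontrl e' (rl' p') = p' /\ tcontrr e' (rr' p') = p') ->
  counital_coactions dC rl rr.
Proof.
move=> e'P f_inj g_inj e'r e eP p.
(* Uniqueness of counits: [e' \o f] is a left counit by [h] and [e] is a right one, so at c both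
   equal [(e' \o f) ⊗ e] applied to Δ(c). *)
have e'f c : e' (f c) = e c.
  have h : tcontrl (e' \o f) (dC c) = c.
    apply: f_inj; rewrite -(tcontrl_tmap (e' := e') (f := f) f) // dCE.
    exact: (e'P _).1.
  rewrite -{1}[c](eP c).2.
  have <- : e (tcontrl (e' \o f) (dC c)) = e' (f (tcontrr e (dC c))).
    have [s ->] := tensP (dC c); rewrite !linear_sum; apply: eq_bigr => q _ /=.
    by rewrite tcontrrE tcontrlE !linearZ /=; apply: mulrC.
  by rewrite h.
split; apply: g_inj.
- by rewrite -(tcontrl_tmap (e' := e') (f := f) g) // rlE; apply: (e'r _).1.
- by rewrite -(tcontrr_tmap (e' := e') (f := f) g) // rrE; apply: (e'r _).2.
Qed.

End DorrohTransport.

Lemma counital_coactions_surj (C P P' : lmodType k) (dC : {linear C -> C ⊗ C})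
    (rl : {linear P -> C ⊗ P}) (rr : {linear P -> P ⊗ C})
    (rl' : {linear P' -> C ⊗ P'}) (rr' : {linear P' -> P' ⊗ C})
    (g : {linear P -> P'}) :
  (forall p, tmap idfun g (rl p) = rl' (g p)) ->
  (forall p, tmap g idfun (rr p) = rr' (g p)) ->
  (forall p', exists p, p' = g p) ->
  counital_coactions dC rl rr -> counital_coactions dC rl' rr'.
Proof.
move=> rlE rrE gS H e eP p'; have [p ->] := gS p'; have [lp rp] := H e eP p.
rewrite -rlE -rrE (tcontrl_tmap (e := e) (e' := e)) //.
rewrite (tcontrr_tmap (e := e) (e' := e)) //.
by rewrite lp rp.
Qed.

End Transport.

(** * The pairs in T and the projections of T to D and Q *)

Section SubspaceTheory.
Variables (k : fieldType) (C P : lmodType k).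
Variables (dC : {linear C -> C ⊗ C}) (dP : {linear P -> P ⊗ P}).
Variables (rl : {linear P -> C ⊗ P}) (rr : {linear P -> P ⊗ C}).
Variable T : submodClosed (C * P)%type.

Let D : submodClosed C := subD T.
Let Q : submodClosed P := subQ T.
Let R : submodClosed P := subR T.
Let RQ : submodClosed (subsp Q) := subR_in_Q T.
Let eta : {linear subsp D -> quotsp R} := etaPR T.
Let etaQ : {linear subsp D -> quotsp RQ} := etaQR T.

Let dD := sub_comul dC D.
Let lD := sub_lcoact dC D.
Let rD := sub_rcoact dC D.
Let dQ := sub_comul dP Q.
Let lQ := sub_lcoact rl Q.
Let rQ := sub_rcoact rr Q.
Let lQ_D := sub_lcoact_in rl Q D.
Let rQ_D := sub_rcoact_in rr Q D.
Let dQR := quot_comul dQ RQ.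
Let lQR := quot_lcoact lQ RQ.
Let rQR := quot_rcoact rQ RQ.
Let lQR_D := quot_lcoact lQ_D RQ.
Let rQR_D := quot_rcoact rQ_D RQ.

Let T_sub := subcoalgebra (Dorroh_comul dC dP rl rr) T.

(** The retractions serve only to corestrict: the components of an element of T already lie in D and
    Q. *)
Definition subT_D : {linear subsp T -> subsp D} := retr D \o fst \o incl T.
Definition subT_Q : {linear subsp T -> subsp Q} := retr Q \o snd \o incl T.

Lemma subD_mem c p : (c, p) \in T -> c \in D.
Proof. by move=> cp; apply/asboolP; exists p. Qed.

Lemma subQ_mem c p : (c, p) \in T -> p \in Q.
Proof. by move=> cp; apply/asboolP; exists c. Qed.

Lemma incl_subT_D x : incl D (subT_D x) = (incl T x).1.
Proof.
rewrite /= retrK //; apply: (@subD_mem _ (incl T x).2).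
by rewrite -surjective_pairing inclP.
Qed.

Lemma incl_subT_Q x : incl Q (subT_Q x) = (incl T x).2.
Proof.
rewrite /= retrK //; apply: (@subQ_mem (incl T x).1).
by rewrite -surjective_pairing inclP.
Qed.

Lemma incl_subT_mem x : (incl D (subT_D x), incl Q (subT_Q x)) \in T.
Proof. by rewrite incl_subT_D incl_subT_Q -surjective_pairing inclP. Qed.

Lemma subQ_ex (q : subsp Q) : exists c : subsp D, (incl D c, incl Q q) \in T.
Proof.
have /asboolP[c cq] := inclP q.
by have [c' c'E] := inclT (subD_mem cq); exists c'; rewrite c'E.
Qed.

(** Elements of R are partners of 0, so facts about pairs in T apply to them with c = 0, where the
    terms in η vanish. *)
Lemma subRQ_mem (q : subsp Q) : q \in RQ -> (incl D 0, incl Q q) \in T.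
Proof. by rewrite linear0. Qed.

(* The embedding of Q/R into P/R, which identifies etaQR with etaPR. *)
Definition quotQ_quotP : {linear quotsp RQ -> quotsp R} := qpi R \o incl Q \o sect RQ.

Lemma quotQ_quotPE q : quotQ_quotP (qpi RQ q) = qpi R (incl Q q).
Proof.
apply/qpiP; rewrite /= -(linearB (incl Q)) sect_qpi addrAC subrr add0r linearN.
apply: subspN; exact: (inclP (retr RQ q)).
Qed.

Lemma quotQ_quotP_eta c : quotQ_quotP (etaQ c) = eta c.
Proof. exact: quotQ_quotPE. Qed.

(** Used with coordinate projections, which isolate one summand, and with [qpi T] on one factor,
    where the four summands have to cancel. *)
Lemma tmap_Dorroh_comul (X Y : lmodType k) (f : {linear (C * P)%type -> X})
    (g : {linear (C * P)%type -> Y}) c p :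
  tmap f g (Dorroh_comul dC dP rl rr (c, p)) =
    tmap (f \o @inC _ C P) (g \o @inC _ C P) (dC c)
    + tmap (f \o @inC _ C P) (g \o @inP _ C P) (rl p)
    + tmap (f \o @inP _ C P) (g \o @inC _ C P) (rr p)
    + tmap (f \o @inP _ C P) (g \o @inP _ C P) (dP p).
Proof. by rewrite /Dorroh_comul /= !linearD /= !tmap_comp. Qed.

(** * Consequences of T being a subcoalgebra *)

Section Subcoalgebra.
Hypothesis TP : T_sub.

(** [fst] kills the copy of P and [snd] that of C, so each pair of projections retains exactly one
    summand of the comultiplication. *)
Lemma Dorroh_comul_subT c q : (incl D c, incl Q q) \in T ->
  exists s : subsp T ⊗ subsp T,
  [/\ dC (incl D c) = tmap (incl D) (incl D) (tmap subT_D subT_D s),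
      rl (incl Q q) = tmap (incl D) (incl Q) (tmap subT_D subT_Q s),
      rr (incl Q q) = tmap (incl Q) (incl D) (tmap subT_Q subT_D s)
    & dP (incl Q q) = tmap (incl Q) (incl Q) (tmap subT_Q subT_Q s)].
Proof.
move=> cq; have [s sE] := TP cq; exists s.
have iD x : fst (incl T x) = incl D (subT_D x) by rewrite incl_subT_D.
have iQ x : snd (incl T x) = incl Q (subT_Q x) by rewrite incl_subT_Q.
split.
- rewrite -(tmap_comp2 _ iD iD) -sE tmap_Dorroh_comul (tmap_0r _ (rl _)) // (tmap_0l _ (rr _)) //.
  by rewrite (tmap_0l _ (dP _)) // !addr0 tmap_id.
- rewrite -(tmap_comp2 _ iD iQ) -sE tmap_Dorroh_comul (tmap_0r _ (dC _)) // (tmap_0l _ (rr _)) //.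
  by rewrite (tmap_0l _ (dP _)) // !addr0 add0r tmap_id.
- rewrite -(tmap_comp2 _ iQ iD) -sE tmap_Dorroh_comul (tmap_0l _ (dC _)) // (tmap_0l _ (rl _)) //.
  by rewrite (tmap_0r _ (dP _)) // !addr0 !add0r tmap_id.
- rewrite -(tmap_comp2 _ iQ iQ) -sE tmap_Dorroh_comul (tmap_0l _ (dC _)) // (tmap_0l _ (rl _)) //.
  by rewrite (tmap_0r _ (rr _)) // !add0r tmap_id.
Qed.

(** A single [s] represents all four maps, so identities between them reduce to [etaQ_subT] and
    [eta_subT] on its factors. *)
Lemma comul_subT c q : (incl D c, incl Q q) \in T ->
  exists s : subsp T ⊗ subsp T,
  [/\ dD c = tmap subT_D subT_D s, lQ_D q = tmap subT_D subT_Q s,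
      rQ_D q = tmap subT_Q subT_D s & dQ q = tmap subT_Q subT_Q s].
Proof.
move=> cq; have [s [E1 E2 E3 E4]] := Dorroh_comul_subT cq; exists s.
have KD := @inclK k C D; have KQ := @inclK k P Q.
split.
- by rewrite /dD /sub_comul /= E1 (tmap_cancel KD KD).
- by rewrite /lQ_D /sub_lcoact_in /= E2 (tmap_cancel KD KQ).
- by rewrite /rQ_D /sub_rcoact_in /= E3 (tmap_cancel KQ KD).
- by rewrite /dQ /sub_comul /= E4 (tmap_cancel KQ KQ).
Qed.

Lemma subT_subcoalgebraD : subcoalgebra dC D.
Proof.
move=> c /asboolP[p cp].
have [c' c'E] := inclT (subD_mem cp); have [q qE] := inclT (subQ_mem cp).
have [|s [sE _ _ _]] := @Dorroh_comul_subT c' q; first by rewrite c'E qE.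
by exists (tmap subT_D subT_D s); rewrite -c'E.
Qed.

Lemma subT_Q_in p : p \in Q ->
  [/\ in_tensor D Q (rl p), in_tensor Q D (rr p) & in_tensor Q Q (dP p)].
Proof.
move=> /inclT[q <-]; have [c cq] := subQ_ex q.
have [s [_ E2 E3 E4]] := Dorroh_comul_subT cq.
split; [exists (tmap subT_D subT_Q s) | exists (tmap subT_Q subT_D s)
  | exists (tmap subT_Q subT_Q s)]; exact.
Qed.

Lemma etaQ_subT x : etaQ (subT_D x) = qpi RQ (subT_Q x).
Proof. exact/etaQE/incl_subT_mem. Qed.

Lemma eta_subT x : eta (subT_D x) = qpi R (incl Q (subT_Q x)).
Proof. exact/etaE/incl_subT_mem. Qed.

Section Element.
Variables (c : subsp D) (q : subsp Q).
Hypothesis cq : (incl D c, incl Q q) \in T.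

(** With c = 0 these identities place the structure maps on R in the kernels that make R a C-Coideal
    of Q; for general c they express the homomorphism properties of η. *)
Lemma etaQ_comul :
  [/\ tmap etaQ etaQ (dD c) = tmap (qpi RQ) (qpi RQ) (dQ q),
      tmap idfun etaQ (dD c) = tmap idfun (qpi RQ) (lQ_D q)
    & tmap etaQ idfun (dD c) = tmap (qpi RQ) idfun (rQ_D q)].
Proof.
have [s [-> -> -> ->]] := comul_subT cq.
by split; apply: tmap_comp2 => // x; apply: etaQ_subT.
Qed.

Lemma eta_coact :
  tmap eta (incl Q) (lQ_D q) = tmap (qpi R) idfun (dP (incl Q q)) /\
  tmap (incl Q) eta (rQ_D q) = tmap idfun (qpi R) (dP (incl Q q)).
Proof.
have QP : subcoalgebra dP Q by move=> p /subT_Q_in[].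
rewrite -(sub_comulE QP) -/dQ; have [s [_ -> -> ->]] := comul_subT cq.
by split; rewrite !tmap_comp; apply: eq_tmap => // x; apply: eta_subT.
Qed.

End Element.
End Subcoalgebra.

(** * Coactions of D in place of C, and the structures induced on Q and Q/R *)

Section Contained.
Hypothesis DP : subcoalgebra dC D.
Hypothesis QP : subcoalgebra dP Q.
Hypothesis lP : forall p, p \in Q -> in_tensor D Q (rl p).
Hypothesis rP : forall p, p \in Q -> in_tensor Q D (rr p).

(** The coaction of C already lands in D ⊗ Q, so retracting onto D loses nothing and including D
    back recovers it. *)
Lemma sub_lcoact_in_incl q : tmap (incl D) idfun (lQ_D q) = lQ q.
Proof.
have [s sE] := lP (inclP q); rewrite /lQ_D /sub_lcoact_in /lQ /sub_lcoact /= sE.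
rewrite (tmap_cancel (@inclK k C D) (@inclK k P Q)) tmap_comp.
by apply: eq_tmap => // x /=; rewrite inclK.
Qed.

Lemma sub_rcoact_in_incl q : tmap idfun (incl D) (rQ_D q) = rQ q.
Proof.
have [s sE] := rP (inclP q); rewrite /rQ_D /sub_rcoact_in /rQ /sub_rcoact /= sE.
rewrite (tmap_cancel (@inclK k P Q) (@inclK k C D)) tmap_comp.
by apply: eq_tmap => // x /=; rewrite inclK.
Qed.

Lemma sub_comul_incll c : tmap (incl D) idfun (dD c) = lD c.
Proof.
have [s sE] := DP (inclP c); rewrite /dD /sub_comul /lD /sub_lcoact /= sE.
rewrite (tmap_cancel (@inclK k C D) (@inclK k C D)) tmap_comp.
by apply: eq_tmap => // x /=; rewrite inclK.
Qed.

Lemma sub_comul_inclr c : tmap idfun (incl D) (dD c) = rD c.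
Proof.
have [s sE] := DP (inclP c); rewrite /dD /sub_comul /rD /sub_rcoact /= sE.
rewrite (tmap_cancel (@inclK k C D) (@inclK k C D)) tmap_comp.
by apply: eq_tmap => // x /=; rewrite inclK.
Qed.

Lemma subbicomodule_in : subbicomodule rl rr Q.
Proof.
move=> p pQ; have [[s ->] [s' ->]] := (lP pQ, rP pQ); split.
- by exists (tmap (incl D) idfun s); rewrite tmap_comp; apply: eq_tmap.
- by exists (tmap idfun (incl D) s'); rewrite tmap_comp; apply: eq_tmap.
Qed.

(** The D-coaction is the C-coaction retracted onto D, and this retraction sends C ⊗ R to D ⊗ R;
    likewise on the right. *)
Lemma subbicomodule_RQ : subbicomodule lQ rQ RQ -> subbicomodule lQ_D rQ_D RQ.
Proof.
move=> H; rewrite /subbicomodule => q qR; have [[s sE] [s' s'E]] := H q qR; split.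
- exists (tmap (retr D) idfun s).
  rewrite -[LHS](@tmap_inclKl _ _ _ D) sub_lcoact_in_incl sE.
  exact: tmap_comp2.
- exists (tmap idfun (retr D) s').
  rewrite -[LHS](@tmap_inclKr _ _ _ D) sub_rcoact_in_incl s'E.
  exact: tmap_comp2.
Qed.

Hypothesis RQP : subbicomodule lQ rQ RQ.

Lemma quot_lcoact_in q : lQR_D (qpi RQ q) = tmap idfun (qpi RQ) (lQ_D q).
Proof. exact: quot_lcoactE (subbicomodule_RQ RQP) q. Qed.

Lemma quot_rcoact_in q : rQR_D (qpi RQ q) = tmap (qpi RQ) idfun (rQ_D q).
Proof. exact: quot_rcoactE (subbicomodule_RQ RQP) q. Qed.

Lemma quot_lcoact_in_incl x : tmap (incl D) idfun (lQR_D x) = lQR x.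
Proof.
have [q ->] := qpi_surj x; rewrite quot_lcoact_in (quot_lcoactE RQP).
by rewrite -sub_lcoact_in_incl; apply: tmap_comp2.
Qed.

Lemma quot_rcoact_in_incl x : tmap idfun (incl D) (rQR_D x) = rQR x.
Proof.
have [q ->] := qpi_surj x; rewrite quot_rcoact_in (quot_rcoactE RQP).
by rewrite -sub_rcoact_in_incl; apply: tmap_comp2.
Qed.

(** Including D in C turns each D-identity into the corresponding C-identity, and the inclusion
    stays injective after tensoring. *)
Lemma bicomodule_hom_in :
  bicomodule_hom lD rD lQR rQR etaQ <-> bicomodule_hom dD dD lQR_D rQR_D etaQ.
Proof.
have lE c : tmap (incl D) idfun (tmap idfun etaQ (dD c)) = tmap idfun etaQ (lD c).
  by rewrite -sub_comul_incll; apply: tmap_comp2.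
have rE c : tmap idfun (incl D) (tmap etaQ idfun (dD c)) = tmap etaQ idfun (rD c).
  by rewrite -sub_comul_inclr; apply: tmap_comp2.
split=> H c; have [lH rH] := H c; split.
- by apply: (can_inj (@tmap_inclKl _ _ _ D)); rewrite lE lH quot_lcoact_in_incl.
- by apply: (can_inj (@tmap_inclKr _ _ _ D)); rewrite rE rH quot_rcoact_in_incl.
- by rewrite -lE lH quot_lcoact_in_incl.
- by rewrite -rE rH quot_rcoact_in_incl.
Qed.

Lemma Dorroh_axioms_sub :
  Dorroh_axioms dC dP rl rr -> Dorroh_axioms dD dQ lQ_D rQ_D.
Proof.
apply: (@Dorroh_axioms_inj _ _ _ _ _ _ _ _ _ _ _ _ _ (incl D) (incl Q))
  (@inclK _ _ _) (@inclK _ _ _).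
- exact: sub_comulE.
- exact: sub_comulE.
- exact: sub_lcoact_inE.
- exact: sub_rcoact_inE.
Qed.

(** The axioms pass forward along the identity of D and the surjection Q -> Q/R. *)
Lemma Dorroh_axioms_quot : coideal dQ RQ ->
  Dorroh_axioms dD dQ lQ_D rQ_D -> Dorroh_axioms dD dQR lQR_D rQR_D.
Proof.
move=> RQc.
apply: (@Dorroh_axioms_surj _ _ _ _ _ _ _ _ _ _ _ _ _ idfun (qpi RQ)).
- by move=> c; rewrite tmap_id.
- by move=> q; rewrite (quot_comulE RQc).
- by move=> q; rewrite -quot_lcoact_in.
- by move=> q; rewrite -quot_rcoact_in.
- by move=> c; exists c.
- exact: qpi_surj.
Qed.

Lemma counital_coactions_sub (e : {linear C -> k^o}) : is_counit dC e ->
  (forall p, tcontrl e (rl p) = p /\ tcontrr e (rr p) = p) ->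
  counital_coactions dD lQ_D rQ_D.
Proof.
move=> eP er.
apply: (@counital_coactions_inj _ _ _ _ _ _ _ _ _ _ _ (incl D) (incl Q) _ _ _ e).
- exact: sub_comulE.
- exact: sub_lcoact_inE.
- exact: sub_rcoact_inE.
- exact: eP.
- exact: incl_inj.
- exact: incl_inj.
- exact: er.
Qed.

Lemma counital_coactions_quot :
  counital_coactions dD lQ_D rQ_D -> counital_coactions dD lQR_D rQR_D.
Proof.
apply: (@counital_coactions_surj _ _ _ _ _ _ _ _ _ (qpi RQ)).
- by move=> q; rewrite -quot_lcoact_in.
- by move=> q; rewrite -quot_rcoact_in.
- exact: qpi_surj.
Qed.

(** * Sufficiency of the conditions: the comultiplication maps T into T ⊗ T *)

Lemma bicomodule_hom_subcoalgebra :
  bicomodule_hom dD dD lQR_D rQR_D etaQ ->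
  (forall q : subsp Q,
     tmap eta (incl Q) (lQ_D q) = tmap (qpi R) idfun (dP (incl Q q)) /\
     tmap (incl Q) eta (rQ_D q) = tmap idfun (qpi R) (dP (incl Q q))) ->
  T_sub.
Proof.
move=> homD etaP [c0 p0] cp0.
have [c cE] := inclT (subD_mem cp0); have [q qE] := inclT (subQ_mem cp0).
move: cp0; rewrite -{}cE -{}qE => cq {c0 p0}.
have [lH rH] := homD c; have [L2 R2] := etaP q.
have etaQc : etaQ c = qpi RQ q by apply: etaQE.
rewrite etaQc quot_lcoact_in in lH; rewrite etaQc quot_rcoact_in in rH.
(* [L1] and [R1] are the bicomodule identities moved from Q/R to P/R and from D to C; η on the left
   factor goes with the right coaction, and conversely. *)
have L1 : tmap eta (incl D) (dD c) = tmap (qpi R) idfun (rr (incl Q q)).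
  rewrite -(sub_rcoact_inE rP)
    -(@tmap_comp1 _ _ _ _ _ _ _ etaQ idfun quotQ_quotP (incl D)) //.
    by rewrite rH; apply: tmap_comp2 => // x; apply: quotQ_quotPE.
  exact: quotQ_quotP_eta.
have R1 : tmap (incl D) eta (dD c) = tmap idfun (qpi R) (rl (incl Q q)).
  rewrite -(sub_lcoact_inE lP)
    -(@tmap_comp1 _ _ _ _ _ _ _ idfun etaQ (incl D) quotQ_quotP) //.
    by rewrite lH; apply: tmap_comp2 => // x; apply: quotQ_quotPE.
  exact: quotQ_quotP_eta.
(* The map P/R -> X/T induced by the inclusion of P; [thetaP] shows that the representative chosen
   by [sect] does not matter. *)
pose theta : {linear quotsp R -> quotsp T} := qpi T \o @inP _ C P \o sect R.
have thetaP p : qpi T (inP C p) = theta (qpi R p).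
  apply/qpiP; rewrite -linearB /= sect_qpi opprB addrC subrK.
  exact: (inclP (retr R p)).
(* If (d, p) is in T, then (d, 0) and -(0, p) agree modulo T. *)
have thetaD d : qpi T (inC P (incl D d)) = - theta (eta d).
  rewrite -thetaP -linearN; apply/qpiP.
  have -> : inC P (incl D d) - - inP C (incl Q (eta_lift d)) =
      (incl D d, incl Q (eta_lift d)).
    by rewrite opprK; congr (_, _); rewrite /= ?addr0 ?add0r.
  exact: eta_liftP.
apply: in_tensor_ker; rewrite tmap_Dorroh_comul.
- have -> : tmap (qpi T \o @inC _ C P) (idfun \o @inC _ C P) (dC (incl D c)) =
      - tmap theta (@inC _ C P) (tmap eta (incl D) (dD c)).
    by rewrite -(sub_comulE DP) tmap_comp tmap_comp;
      apply: tmapNl => // x; apply: thetaD.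
  have -> : tmap (qpi T \o @inC _ C P) (idfun \o @inP _ C P) (rl (incl Q q)) =
      - tmap theta (@inP _ C P) (tmap eta (incl Q) (lQ_D q)).
    by rewrite -(sub_lcoact_inE lP) tmap_comp tmap_comp;
      apply: tmapNl => // x; apply: thetaD.
  have -> : tmap (qpi T \o @inP _ C P) (idfun \o @inC _ C P) (rr (incl Q q)) =
      tmap theta (@inC _ C P) (tmap (qpi R) idfun (rr (incl Q q))).
    by rewrite tmap_comp; apply: eq_tmap.
  have -> : tmap (qpi T \o @inP _ C P) (idfun \o @inP _ C P) (dP (incl Q q)) =
      tmap theta (@inP _ C P) (tmap (qpi R) idfun (dP (incl Q q))).
    by rewrite tmap_comp; apply: eq_tmap.
  (* By [L1] the term of Δ on C cancels that of the right coaction; by [L2] the left coaction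
     cancels Δ on P. *)
  by rewrite L1 L2 [X in X + _]addrAC addNr add0r addNr.
- have -> : tmap (idfun \o @inC _ C P) (qpi T \o @inC _ C P) (dC (incl D c)) =
      - tmap (@inC _ C P) theta (tmap (incl D) eta (dD c)).
    by rewrite -(sub_comulE DP) tmap_comp tmap_comp;
      apply: tmapNr => // x; apply: thetaD.
  have -> : tmap (idfun \o @inP _ C P) (qpi T \o @inC _ C P) (rr (incl Q q)) =
      - tmap (@inP _ C P) theta (tmap (incl Q) eta (rQ_D q)).
    by rewrite -(sub_rcoact_inE rP) tmap_comp tmap_comp;
      apply: tmapNr => // x; apply: thetaD.
  have -> : tmap (idfun \o @inC _ C P) (qpi T \o @inP _ C P) (rl (incl Q q)) =
      tmap (@inC _ C P) theta (tmap idfun (qpi R) (rl (incl Q q))).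
    by rewrite tmap_comp; apply: eq_tmap.
  have -> : tmap (idfun \o @inP _ C P) (qpi T \o @inP _ C P) (dP (incl Q q)) =
      tmap (@inP _ C P) theta (tmap idfun (qpi R) (dP (incl Q q))).
    by rewrite tmap_comp; apply: eq_tmap.
  (* On this side Δ on C cancels the left coaction by [R1], and the right coaction cancels Δ on P by
     [R2]. *)
  by rewrite R1 R2 addNr add0r addNr.
Qed.

End Contained.
End SubspaceTheory.

(** * Characterization of the subcoalgebras T, with the induced Coalgebra structures and the
    homomorphism η *)

Theorem proposition3p3 (k : fieldType) (C P : lmodType k)
    (dC : {linear C -> C ⊗ C}) (dP : {linear P -> P ⊗ P})
    (rl : {linear P -> C ⊗ P}) (rr : {linear P -> P ⊗ C})
    (HCP : Dorroh_pair dC dP rl rr)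
    (T : submodClosed (C * P)%type) :
  let D : submodClosed C := subD T in
  let Q : submodClosed P := subQ T in
  let R : submodClosed P := subR T in
  let RQ : submodClosed (subsp Q) := subR_in_Q T in
  let eta : {linear subsp D -> quotsp R} := etaPR T in
  let etaQ : {linear subsp D -> quotsp RQ} := etaQR T in
  let pi : {linear P -> quotsp R} := qpi R in
  let dD := sub_comul dC D in
  let lD := sub_lcoact dC D in
  let rD := sub_rcoact dC D in
  let dQ := sub_comul dP Q in
  let lQ := sub_lcoact rl Q in
  let rQ := sub_rcoact rr Q in
  let lQ_D := sub_lcoact_in rl Q D in
  let rQ_D := sub_rcoact_in rr Q D in
  let dQR := quot_comul dQ RQ in
  let lQR := quot_lcoact lQ RQ in
  let rQR := quot_rcoact rQ RQ in
  let lQR_D := quot_lcoact lQ_D RQ in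
  let rQR_D := quot_rcoact rQ_D RQ in
  let cond_a := subcoalgebra dC D in
  let cond_b :=
    [/\ subCoalgebra dP rl rr Q,
        Coideal dQ lQ rQ RQ,
        forall p, p \in Q -> in_tensor D Q (rl p)
      & forall p, p \in Q -> in_tensor Q D (rr p)] in
  let cond_c :=
    forall q : subsp Q,
      tmap eta (incl Q) (lQ_D q) = tmap pi idfun (dP (incl Q q)) /\
      tmap (incl Q) eta (rQ_D q) = tmap idfun pi (dP (incl Q q)) in
  let hom_C := bicomodule_hom lD rD lQR rQR etaQ in
  let hom_D := bicomodule_hom dD dD lQR_D rQR_D etaQ in
  let T_sub := subcoalgebra (Dorroh_comul dC dP rl rr) T in
  [/\ T_sub <-> [/\ cond_a, cond_b & hom_C /\ cond_c],
      T_sub <-> [/\ cond_a, cond_b & hom_D /\ cond_c],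
      (* Q and Q/R are D-Coalgebras *)
      cond_a -> cond_b ->
        [/\ Dorroh_axioms dD dQ lQ_D rQ_D,
            Dorroh_axioms dD dQR lQR_D rQR_D
          & has_counit dC ->
              Dorroh_pair dD dQ lQ_D rQ_D /\ Dorroh_pair dD dQR lQR_D rQR_D]
    & (* eta is a homomorphism of coalgebras, C-Coalgebras and D-Coalgebras *)
      T_sub ->
        [/\ coalgebra_hom dD dQR etaQ,
            Coalgebra_hom dD lD rD dQR lQR rQR etaQ
          & Coalgebra_hom dD dD dD dQR lQR_D rQR_D etaQ]].
Proof.
move=> D Q R RQ eta etaQ pi dD lD rD dQ lQ rQ lQ_D rQ_D dQR lQR rQR lQR_D rQR_D.
move=> cond_a cond_b cond_c hom_C hom_D T_sub.
have [dCa dPa rla rra] := HCP.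
(* Both implications are proved for the D-bicomodule form of the condition on η; [homE] then gives
   the C-bicomodule form. *)
have fwd : T_sub -> [/\ cond_a, cond_b & hom_D /\ cond_c].
  move=> TP.
  have a : cond_a by apply: subT_subcoalgebraD TP.
  have lP p : p \in Q -> in_tensor D Q (rl p) by move=> /(subT_Q_in TP)[].
  have rP p : p \in Q -> in_tensor Q D (rr p) by move=> /(subT_Q_in TP)[].
  have QP : subcoalgebra dP Q by move=> p /(subT_Q_in TP)[].
  have RQc : coideal dQ RQ.
    (* Since q is paired with 0, (π ⊗ π)Δ(q) = (η ⊗ η)Δ(0) = 0. *)
    move=> q /subRQ_mem /(etaQ_comul TP)[E _ _]; apply: ker_tmap_qpi.
    by rewrite -E !linear0.
  have RQb : subbicomodule lQ rQ RQ.
    rewrite /subbicomodule => q /subRQ_mem /(etaQ_comul TP)[_ El Er].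
    split; [apply: ker_tmap_qpir | apply: ker_tmap_qpil].
    (* The vanishing is known for the D-coaction and is carried to the C-coaction by including D in
       C. *)
    - transitivity (tmap (incl D) idfun (tmap idfun (qpi RQ) (lQ_D q))).
        by rewrite /lQ -(sub_lcoact_in_incl lP); apply: tmap_comp2.
      by rewrite -El !linear0.
    - transitivity (tmap idfun (incl D) (tmap (qpi RQ) idfun (rQ_D q))).
        by rewrite /rQ -(sub_rcoact_in_incl rP); apply: tmap_comp2.
      by rewrite -Er !linear0.
  have b : cond_b.
    split=> //; split=> //; exact: subbicomodule_in lP rP.
  split=> //; split=> [c|q].
  (* Any partner q of c represents η(c), so the coactions of Q/R may be evaluated at π(q). *)
  - have [q cq] := eta_ex c; have [_ El Er] := etaQ_comul TP cq.
    have -> : etaQ c = qpi RQ q by apply: etaQE.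
    by rewrite (quot_lcoact_in lP rP RQb) (quot_rcoact_in lP rP RQb).
  - by have [c cq] := subQ_ex q; apply: eta_coact TP _ _ cq.
have bwd : [/\ cond_a, cond_b & hom_D /\ cond_c] -> T_sub.
  case=> a [[QP _] [_ RQb] lP rP] [hD hc].
  exact: bicomodule_hom_subcoalgebra hc.
have homE : cond_a -> cond_b -> hom_C <-> hom_D.
  move=> a [_ [_ RQb] lP rP]; exact: bicomodule_hom_in.
split.
- split=> [/fwd[a b [h c]]|[a b [h c]]].
    by split=> //; split=> //; apply/homE.
  by apply: bwd; split=> //; split=> //; apply/homE.
- by split.
- move=> a [[QP _] [RQc RQb] lP rP].
  have Dsub : Dorroh_axioms dD dQ lQ_D rQ_D.
    by apply: Dorroh_axioms_sub => //; split=> //; apply: rla.1.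
  have Dquot : Dorroh_axioms dD dQR lQR_D rQR_D by apply: Dorroh_axioms_quot.
  (* Any counit of D is the restriction of [e], which makes the D-coactions on Q counital; the
     property then passes to Q/R. *)
  split=> // -[e eP].
  have cs : counital_coactions dD lQ_D rQ_D.
    exact: (counital_coactions_sub a lP rP eP (rla.2 e eP)).
  have cq : counital_coactions dD lQR_D rQR_D by apply: counital_coactions_quot.
  by case: Dsub => ? ? ? ?; case: Dquot => ? ? ? ?.
- move=> TP; have [a b [hD hc]] := fwd TP.
  have hcoalg : coalgebra_hom dD dQR etaQ.
    move=> c; have [q cq] := eta_ex c; have [E _ _] := etaQ_comul TP cq.
    have -> : etaQ c = qpi RQ q by apply: etaQE.
    by case: b => _ [RQc _] _ _; rewrite E (quot_comulE RQc).
  by split=> //; split=> //; apply/homE.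
Qed.
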